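(* Let $(X,\nu)$ be a Lebesgue probability space on which the free group $F_m$ acts by measure-preserving transformations. Let $\Pi=(p_{ij})_{i,j\in\mathcal A}$ be a stochastic matrix having a unique stationary distribution $(p_i)_{i\in\mathcal A}$, with $p_i>0$ for all $i\in\mathcal A$. Assume that $\Pi$ generates the free group (i.e. $p_{ij}=0$ if and only if $i+j=0$) and that for all $i,j\in\mathcal A$ $$p_i=p_{-i},\qquad p_{-i,-j}=\frac{p_jp_{ji}}{p_i}.$$ Then for any $\varphi\in L\log L(X,\nu)$ the sequence $s_{2n}^{\Pi}\varphi$ converges as $n\to\infty$, both $\nu$-almost everywhere and in $L_1(X,\nu)$, to an $F_m^2$-invariant function.
   Context: $F_m$ is the free group with free generators $a_1,\dots,a_m$; $T_g$ ($g\in F_m$) denotes the measure-preserving transformation of $(X,\nu)$ given by $g$, $T_i$ is the transformation corresponding to $a_i$, and $T_{-i}=T_i^{-1}$ for $i=1,\dots,m$. $\mathcal A=\{-m,\dots,-1,1,\dots,m\}$; the rows and columns of the $2m\times 2m$ matrix $\Pi$ are indexed by $\mathcal A$. $F_m$ acts on functions by $T_g\varphi=\varphi\circ T_{g^{-1}}$. For a word $w=w_1\dots w_n$ over the alphabet $\mathcal A$ (all words, $|w|=n$ its length) put $T_w=T_{w_1}T_{w_2}\cdots T_{w_n}$, so that $T_w\varphi=\varphi\circ T_w^{-1}$ on functions, $p(w)=p_{w_nw_{n-1}}p_{w_{n-1}w_{n-2}}\cdots p_{w_2w_1}$ (equal to $1$ if $n=1$), and $\pi(w)=p_{w_n}p(w)$.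 Define $$s_n^{\Pi}=\sum_{|w|=n}\pi(w)T_w .$$ $F_m^2$ is the subgroup of words of even length in $F_m$, i.e. the subgroup generated by $a_ia_j$, $i,j\in\{1,\dots,m\}$. $L\log L(X,\nu)=\{\varphi\in L_1(X,\nu):\int_X|\varphi|\log^+|\varphi|\,d\nu<\infty\}$. *)

(* Defs.v *)
From HB Require Import structures.
From mathcomp Require Import all_boot all_order all_algebra.
From mathcomp Require Import all_classical all_reals all_analysis.
From mathcomp Require Import measurable_realfun.
Set Implicit Arguments.
Unset Strict Implicit.
Unset Printing Implicit Defensive.
Import Order.TTheory GRing.Theory Num.Theory.
Import numFieldNormedType.Exports.
Local Open Scope classical_set_scope.
Local Open Scope ring_scope.

(* The alphabet {-m, ..., -1, 1, ..., m}: [(false, i)] stands for the integer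
   i + 1 and [(true, i)] for -(i + 1), so that the integers coded by i and j
   have sum 0 if and only if [j = letter_opp i]. *)
Definition letter (m : nat) : Type := (bool * 'I_m)%type.

Definition letter_opp (m : nat) (i : letter m) : letter m := (~~ i.1, i.2).

Lemma letter_oppK (m : nat) : involutive (@letter_opp m).
Proof. by case=> b i; rewrite /letter_opp /= negbK. Qed.

Definition reduced (m : nat) : pred (seq (letter m)) :=
  sorted (fun i j => j != letter_opp i).

(* The free group of rank m: reduced words, multiplied by concatenating and
   cancelling. *)
Record freegroup (m : nat) : Type := FreeGroup {
  fgword :> seq (letter m);
  fgword_reduced : reduced fgword
}.

HB.instance Definition _ (m : nat) := [isSub for @fgword m].
HB.instance Definition _ (m : nat) := [Choice of freegroup m by <:].

Section FreeGroupLaw.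
Variable m : nat.
Implicit Types (i j : letter m) (u v w : seq (letter m)).

Definition cancel_cons i w : seq (letter m) :=
  if w is j :: w' then if j == letter_opp i then w' else i :: w else [:: i].

Definition word_mul u v : seq (letter m) := foldr cancel_cons v u.
Definition word_inv u : seq (letter m) := rev (map (@letter_opp m) u).

Lemma cancel_cons_reduced i w : reduced w -> reduced (cancel_cons i w).
Proof.
case: w => // j w rw /=; case: eqVneq => [_|nij]; last by rewrite /= nij.
by move: rw; rewrite /reduced /=; apply: path_sorted.
Qed.

Lemma cancel_consK i w :
  reduced w -> cancel_cons i (cancel_cons (letter_opp i) w) = w.
Proof.
case: w => [|j w] /=; first by rewrite eqxx.
rewrite letter_oppK; case: eqVneq => [->|_ _] /=; last by rewrite eqxx.
by case: w => //= k w /andP[/negbTE->].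
Qed.

Lemma word_mul_reduced u v : reduced v -> reduced (word_mul u v).
Proof. by move=> rv; elim: u => //= i u; apply: cancel_cons_reduced. Qed.

Lemma word_mul_cancel i u w : reduced w ->
  word_mul (cancel_cons i u) w = cancel_cons i (word_mul u w).
Proof.
move=> rw; case: u => //= j u; case: eqVneq => // ->.
by rewrite cancel_consK // word_mul_reduced.
Qed.

Lemma word_mulA u v w : reduced w ->
  word_mul u (word_mul v w) = word_mul (word_mul u v) w.
Proof. by move=> rw; elim: u => //= i u ->; rewrite word_mul_cancel. Qed.

Lemma word_muls0 u : reduced u -> word_mul u [::] = u.
Proof.
elim: u => //= i u IHu riu; rewrite IHu; last by apply: path_sorted riu.
by case: u riu {IHu} => //= j u /andP[/negbTE->].
Qed.

Lemma word_mulV u : word_mul (word_inv u) u = [::].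
Proof.
elim: u => //= i u; rewrite /word_inv /= rev_cons /word_mul foldr_rcons /=.
by rewrite letter_oppK eqxx.
Qed.

Lemma word_invK : involutive word_inv.
Proof.
move=> u; rewrite /word_inv map_rev revK -map_comp map_id_in //= => i _.
exact: letter_oppK.
Qed.

Lemma word_inv_reduced u : reduced u -> reduced (word_inv u).
Proof.
rewrite /reduced /word_inv rev_sorted sorted_map; apply: (@sub_sorted _ _ _ _ u).
by move=> i j /=; rewrite letter_oppK eq_sym.
Qed.

Definition fg_one : freegroup m := @FreeGroup m [::] isT.
Definition fg_mul (g h : freegroup m) : freegroup m :=
  FreeGroup (word_mul_reduced g (fgword_reduced h)).
Definition fg_inv (g : freegroup m) : freegroup m :=
  FreeGroup (word_inv_reduced (fgword_reduced g)).

Lemma fg_mulA : associative fg_mul.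
Proof. by move=> g h k; apply/val_inj/word_mulA/fgword_reduced. Qed.
Lemma fg_mul1g : left_id fg_one fg_mul.
Proof. by move=> g; apply/val_inj. Qed.
Lemma fg_mulg1 : right_id fg_one fg_mul.
Proof. by move=> g; apply/val_inj/word_muls0/fgword_reduced. Qed.
Lemma fg_mulVg : left_inverse fg_one fg_inv fg_mul.
Proof. by move=> g; apply/val_inj/word_mulV. Qed.
Lemma fg_mulgV : right_inverse fg_one fg_inv fg_mul.
Proof.
by move=> g; apply/val_inj; rewrite /= -{1}[fgword g]word_invK word_mulV.
Qed.

End FreeGroupLaw.

HB.instance Definition _ (m : nat) := isGroup.Build (freegroup m)
  (@fg_mulA m) (@fg_mul1g m) (@fg_mulg1 m) (@fg_mulVg m) (@fg_mulgV m).

Definition fg_gen (m : nat) (i : letter m) : freegroup m :=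
  @FreeGroup m [:: i] isT.

Lemma fg_gen_opp (m : nat) (i : letter m) :
  fg_gen (letter_opp i) = ((fg_gen i)^-1)%g.
Proof. exact: val_inj. Qed.

Definition fg_even (m : nat) : pred (freegroup m) := fun g => ~~ odd (size g).

Definition fg_of_word (m : nat) (w : seq (letter m)) : freegroup m :=
  (\prod_(i <- w) fg_gen i)%g.

Record mp_action (m : nat) (d : measure_display) (X : measurableType d)
    (R : realType) (nu : set X -> \bar R) (T : freegroup m -> X -> X) : Prop :=
  MPAction {
    mp_action1 : forall x, T 1%g x = x;
    mp_actionM : forall g h x, T (g * h)%g x = T g (T h x);
    mp_action_measurable : forall g, measurable_fun setT (T g);
    mp_action_measure : forall g A, measurable A -> nu (T g @^-1` A) = nu A
  }.

Definition fun_act (m : nat) (X : Type) (R : Type)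
    (T : freegroup m -> X -> X) (g : freegroup m) (phi : X -> R) : X -> R :=
  phi \o T (g^-1)%g.

(* Lebesgue measure on the segment [0, a] plus atoms of mass [c k] at the
   points k + 2; when the total mass is 1, a <= 1 and the atoms lie outside
   the segment. *)
Definition segment_with_atoms (R : realType) (a : R) (c : nat -> R)
    (B : set (measurableTypeR R)) : \bar R :=
  (lebesgue_measure (B `&` [set` `[0%R, a]])
   + \sum_(0 <= k <oo) (c k)%:E * \d_(k.+2%:R : R) B)%E.

(* Lebesgue spaces in the sense of Rokhlin: complete probability spaces
   isomorphic mod 0 to a segment with Lebesgue measure together with at most
   countably many atoms. The sigma-algebra of the model is the completion of
   the Borel sets, hence [completed_algebra_gen]; the measure identity needs
   to be required on Borel sets only. *)
Definition is_lebesgue_space (d : measure_display) (X : measurableType d)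
    (R : realType) (nu : probability X R) : Prop :=
  measure_is_complete nu /\
  exists (a : R) (c : nat -> R),
    let mu := segment_with_atoms a c in
    [/\ 0 <= a, forall k, 0 <= c k, mu setT = 1%E &
      exists (f : X -> measurableTypeR R) (X0 : set X)
             (Y0 : set (measurableTypeR R)),
        [/\ measurable X0 /\ nu (~` X0) = 0%E,
            measurable Y0 /\ mu (~` Y0) = 0%E,
            set_bij X0 Y0 f,
            forall S, S `<=` X0 ->
              (measurable S <-> completed_algebra_gen mu (f @` S)) &
            forall B, measurable B -> B `<=` Y0 ->
              nu (X0 `&` f @^-1` B) = mu B]].

Section MarkovWeights.
Variables (R : realType) (m : nat).
Implicit Types (P : letter m -> letter m -> R) (q : letter m -> R).

Definition is_distribution q : Prop :=
  (forall i, 0 <= q i) /\ \sum_i q i = 1.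

Definition is_stochastic P : Prop := forall i, is_distribution (P i).

Definition is_stationary P q : Prop :=
  is_distribution q /\ forall j, \sum_i q i * P i j = q j.

Definition is_unique_stationary P q : Prop :=
  is_stationary P q /\ forall q', is_stationary P q' -> q' =1 q.

Definition generates_free_group P : Prop :=
  forall i j, P i j = 0 <-> j = letter_opp i.

(* [word_trans P w_1 [:: w_2; ...; w_n]] is
   p_{w_n w_{n-1}} ... p_{w_3 w_2} p_{w_2 w_1}. *)
Fixpoint word_trans P (i : letter m) (w : seq (letter m)) : R :=
  if w is j :: w' then word_trans P j w' * P j i else 1.

(* The value on the empty word is a junk value. *)
Definition word_weight P q (w : seq (letter m)) : R :=
  if w is i :: w' then q (last i w') * word_trans P i w' else 1.

Definition spherical_sum P q (X : Type) (T : freegroup m -> X -> X) (n : nat)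
    (phi : X -> R) (x : X) : R :=
  \sum_(w : n.-tuple (letter m))
    word_weight P q w * fun_act T (fg_of_word w) phi x.

End MarkovWeights.

Definition log_plus (R : realType) (x : R) : R := Num.max 0 (ln x).

(* [ln 0 = 0], so the integrand vanishes where phi does. *)
Definition LlogL (d : measure_display) (X : measurableType d) (R : realType)
    (nu : set X -> \bar R) (phi : X -> R) : Prop :=
  nu.-integrable setT (EFin \o phi) /\
  (\int[nu]_x (`|phi x| * log_plus `|phi x|)%:E < +oo)%E.

(* Main.v *)
Require Import Defs.
From mathcomp Require Import all_boot all_order all_algebra.
From mathcomp Require Import all_classical all_reals all_analysis.
From mathcomp Require Import measurable_realfun ring lra zify.
Import Order.TTheory GRing.Theory Num.Theory.
Import numFieldNormedType.Exports.
Set Implicit Arguments.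
Unset Strict Implicit.
Unset Printing Implicit Defensive.
Local Open Scope classical_set_scope.
Local Open Scope ring_scope.

(** The words of length n, weighted by the chain, are the trajectories of a
    Markov chain on A x X, where A is the alphabet: from (j, x) the chain moves
    to (i, T_j^-1 x) with probability q j i = p_i p_ij / p_j.  Its Markov
    operator is

      (Q f)(j, x) = sum_i q j i f(i, T_j^-1 x),

    it preserves the product of p and nu, and the spherical average of order n
    of phi is the p-average over the first letter of Q^n phi
    ([spherical_sum_sphere]).  The two symmetry conditions say that the adjoint
    of Q is U Q U, where U is the measure-preserving involution
    (U f)(j, x) = f(-j, T_j^-1 x) ([expect_step_adj]).  Uniqueness of the
    stationary distribution forces at least two generators ([rank_gt1]), hence
    more than two letters.

    Mean convergence for bounded f.  The energies |Q^n f|^2 decrease, so their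
    increments tend to 0; such an increment is a sum of conditional variances,
    so all the letters of Q^n f eventually look alike, and Q^(n+1) f is close
    to U Q^n f in mean ([regular], [flip_regular]).  Moving steps across the
    inner product, <Q^2n f, Q^2k f> is then close to |Q^(n+k) f|^2, which makes
    the even iterates a Cauchy sequence ([cauchy_energy]).

    Maximal inequality.  Choosing where each iterate is the largest turns the
    maximum of the Q^(2k+2) h into a sum of pairings with weights b_k of sum at
    most 1.  Because there are more than two letters, Q is bounded by a
    constant times Q U Q on nonnegative functions ([step_flip_step]); by the
    adjoint formula the pairings become those of Q^k h' with Q^k b'_k, as in
    Rota's alternating procedure, where b'_k is again such a family of weights
    and h' = Q^2 h.  These are controlled by a
    potential, the relative entropy of Q^n (1 + lambda h') with respect to
    Q^n (1 + b'_0 + ... + b'_(n-1)): it is nonnegative, it decreases along Q by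
    joint convexity, and it pays for each pairing ([entropy_telescope]).  The
    outcome ([entropy_maximal_inequality]) bounds the mean of the maximal
    function by a constant times the sum of 1 / lambda and of twice the
    integral of h log (1 + lambda h), for every lambda > 0.

    Almost everywhere convergence.  The limit psi of the even iterates of a
    bounded f is fixed by Q^2, so Q^(2n+2k) f - psi is dominated by the maximal
    function of |Q^2k f - psi|, which is small in mean ([bounded_ae_cvg]).  In
    L log L the truncation error of phi has a small maximal function
    ([sphere_approx]), and Banach's principle ([ae_cvg_approx]) extends the
    convergence; the maximal function of |phi| dominates the averages, which
    gives convergence in L1.  Finally the averages are asymptotically invariant
    under products of two letters ([regular2]), so their limit is invariant
    under the even subgroup ([sphere_limit], [even_invariant]). *)

(** * Means of bounded measurable functions *)

Section BoundedMeasurable.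
Context (d : measure_display) (X : measurableType d) (R : realType).
Variable nu : probability X R.
Implicit Types f g : X -> R.

Definition bounded_mfun f : Prop :=
  measurable_fun setT f /\ exists M, forall x, `|f x| <= M.

Definition mean f : R := \int[nu]_x f x.

Lemma bmf_cst c : bounded_mfun (fun _ => c).
Proof. by split; [exact: measurable_cst | exists `|c|]. Qed.

Lemma bmfD f g : bounded_mfun f -> bounded_mfun g ->
  bounded_mfun (fun x => f x + g x).
Proof.
move=> [mf [M fM]] [mg [N gN]]; split; first exact: measurable_funD.
by exists (M + N) => x; rewrite (le_trans (ler_normD _ _))// lerD.
Qed.

Lemma bmfM f g : bounded_mfun f -> bounded_mfun g ->
  bounded_mfun (fun x => f x * g x).
Proof.
move=> [mf [M fM]] [mg [N gN]]; split; first exact: measurable_funM.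
by exists (M * N) => x; rewrite normrM ler_pM.
Qed.

Lemma bmfZ c f : bounded_mfun f -> bounded_mfun (fun x => c * f x).
Proof. exact/bmfM/bmf_cst. Qed.

Lemma bmfN f : bounded_mfun f -> bounded_mfun (fun x => - f x).
Proof. by move=> /(bmfZ (-1)); under eq_fun do rewrite mulN1r. Qed.

Lemma bmfB f g : bounded_mfun f -> bounded_mfun g ->
  bounded_mfun (fun x => f x - g x).
Proof. by move=> bf /bmfN; exact: bmfD. Qed.

Lemma bmf_norm f : bounded_mfun f -> bounded_mfun (fun x => `|f x|).
Proof.
move=> [mf [M fM]]; split; first exact: measurableT_comp.
by exists M => x; rewrite normr_id.
Qed.

Lemma bmfX f n : bounded_mfun f -> bounded_mfun (fun x => f x ^+ n).
Proof.
move=> bf; elim: n => [|n IHn]; first exact: bmf_cst.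
by under eq_fun do rewrite exprS; exact: bmfM.
Qed.

Lemma bmf_max f g : bounded_mfun f -> bounded_mfun g ->
  bounded_mfun (fun x => Num.max (f x) (g x)).
Proof.
move=> [mf [M fM]] [mg [N gN]]; split; first exact: measurable_maxr.
exists (M + N) => x; have := fM x; have := gN x.
by rewrite maxEle; case: ifP => _; have := normr_ge0 (f x);
  have := normr_ge0 (g x); lra.
Qed.

Lemma bmf_sum I (s : seq I) (F : I -> X -> R) :
  (forall i, bounded_mfun (F i)) -> bounded_mfun (fun x => \sum_(i <- s) F i x).
Proof.
move=> bF; elim: s => [|i s IHs].
  by under eq_fun do rewrite big_nil; exact: bmf_cst.
by under eq_fun do rewrite big_cons; exact: bmfD.
Qed.

Lemma bmf_comp f (t : X -> X) : measurable_fun setT t -> bounded_mfun f ->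
  bounded_mfun (fun x => f (t x)).
Proof.
by move=> mt [mf [M fM]]; split; [exact: measurableT_comp | exists M].
Qed.

Lemma bmf_indicator (b : X -> bool) : measurable_fun setT b ->
  bounded_mfun (fun x => (b x)%:R).
Proof.
move=> mb; split.
  by apply: (measurableT_comp (f := fun c : bool => c%:R : R)).
by exists 1 => x; case: (b x); rewrite ?normr1 ?normr0.
Qed.

Lemma bmf_integrable f : bounded_mfun f -> nu.-integrable setT (EFin \o f).
Proof.
move=> [mf [M fM]]; apply: measurable_bounded_integrable => //; first exact: fin_num_fun_lty.
by exists M; split => [|N MN x _]; [exact: num_real | exact/le_trans/ltW/MN].
Qed.

Lemma meanD f g : bounded_mfun f -> bounded_mfun g ->
  mean (fun x => f x + g x) = mean f + mean g.
Proof. by move=> /bmf_integrable bf /bmf_integrable bg; exact: RintegralD. Qed.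

Lemma meanB f g : bounded_mfun f -> bounded_mfun g ->
  mean (fun x => f x - g x) = mean f - mean g.
Proof. by move=> /bmf_integrable bf /bmf_integrable bg; exact: RintegralB. Qed.

Lemma meanZ c f : bounded_mfun f -> mean (fun x => c * f x) = c * mean f.
Proof. by move=> /bmf_integrable bf; exact: RintegralZl. Qed.

Lemma mean_cst c : mean (fun _ => c) = c.
Proof.
have n1 : nu [set: X] = 1%E by exact: (@probability_setT _ _ _ nu).
by rewrite /mean Rintegral_cst//= n1 mulr1.
Qed.

Lemma mean_sum I (s : seq I) (F : I -> X -> R) :
  (forall i, bounded_mfun (F i)) ->
  mean (fun x => \sum_(i <- s) F i x) = \sum_(i <- s) mean (F i).
Proof.
move=> bF; elim: s => [|i s IHs].
  by under eq_fun do rewrite big_nil; rewrite big_nil mean_cst.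
under eq_fun do rewrite big_cons; rewrite big_cons -IHs.
by apply: meanD => //; exact: bmf_sum.
Qed.

Lemma mean_le f g : bounded_mfun f -> bounded_mfun g ->
  (forall x, f x <= g x) -> mean f <= mean g.
Proof.
by move=> /bmf_integrable bf /bmf_integrable bg fg; exact: le_Rintegral.
Qed.

Lemma mean_ge0 f : (forall x, 0 <= f x) -> 0 <= mean f.
Proof. by move=> f0; exact: Rintegral_ge0. Qed.

Lemma mean_comp f (t : X -> X) : measurable_fun setT t ->
  (forall A, measurable A -> nu (t @^-1` A) = nu A) ->
  bounded_mfun f -> mean (fun x => f (t x)) = mean f.
Proof.
move=> mt nut bf; rewrite /mean /Rintegral; congr fine.
have mf := measurable_int _ (bmf_integrable bf).
have mft := bmf_integrable (bmf_comp mt bf).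
transitivity (\int[pushforward nu t]_y (EFin \o f) y)%E; last first.
  by apply: eq_measure_integral => A mA _; exact: nut.
by rewrite (integral_pushforward mt) //.
Qed.

Lemma EFin_mean f : bounded_mfun f -> (mean f)%:E = (\int[nu]_x (f x)%:E)%E.
Proof.
move=> /bmf_integrable bf; rewrite /mean /Rintegral fineK//.
exact: integrable_fin_num.
Qed.

End BoundedMeasurable.

(** * The Markov operator of a reversible skew product *)

(** The data of a chain on A x X that moves from (j, x) to (i, tau j x) with
    probability q j i.  The field [rc_reversible] says that time reversal,
    combined with the involution opp of the letters, preserves the chain;
    together with [rc_q_sum] it makes p stationary.  The fields [rc_q_gt0] and
    [rc_card] leave at least two choices for the next letter. *)
Record reversible_chain (d : measure_display) (X : measurableType d)
    (R : realType) (nu : probability X R) (A : finType) (opp : A -> A)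
    (tau : A -> X -> X) (p : A -> R) (q : A -> A -> R) : Prop :=
  ReversibleChain {
    rc_oppK : involutive opp;
    rc_measurable : forall j, measurable_fun setT (tau j);
    rc_preserving : forall j B, measurable B -> nu (tau j @^-1` B) = nu B;
    rc_tauK : forall j x, tau (opp j) (tau j x) = x;
    rc_p_gt0 : forall j, 0 < p j;
    rc_p_sum : \sum_j p j = 1;
    rc_p_opp : forall j, p (opp j) = p j;
    rc_q_ge0 : forall j i, 0 <= q j i;
    rc_q_sum : forall j, \sum_i q j i = 1;
    rc_q_gt0 : forall j i, i != opp j -> 0 < q j i;
    rc_reversible : forall j i, p j * q j i = p i * q (opp i) (opp j);
    rc_card : (2 < #|A|)%N
  }.

Section MarkovOperator.
Context (d : measure_display) (X : measurableType d) (R : realType).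
Context (nu : probability X R) (A : finType) (opp : A -> A).
Context (tau : A -> X -> X) (p : A -> R) (q : A -> A -> R).
Implicit Types f g : A -> X -> R.

Definition bounded_family f : Prop := forall j, bounded_mfun (f j).
(** The integral over A x X of a family indexed by A, for the product of p
    and nu. *)
Definition expect f : R := \sum_j p j * mean nu (f j).
Definition step f j x : R := \sum_i q j i * f i (tau j x).
Definition flip f j x : R := f (opp j) (tau j x).

Hypothesis C : reversible_chain nu opp tau p q.

Lemma bfam_flip f : bounded_family f -> bounded_family (flip f).
Proof. by move=> bf j; apply: bmf_comp; [exact: rc_measurable C j|exact: bf]. Qed.

Lemma bfam_step f : bounded_family f -> bounded_family (step f).
Proof.
move=> bf j; apply: bmf_sum => i; apply: bmfZ.
by apply: (bmf_comp (f := f i)); [exact: rc_measurable C j|exact: bf].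
Qed.

Lemma bfam_iter n f : bounded_family f -> bounded_family (iter n step f).
Proof. by move=> bf; elim: n => //= n; exact: bfam_step. Qed.

Lemma bfamD f g : bounded_family f -> bounded_family g ->
  bounded_family (fun j x => f j x + g j x).
Proof. by move=> bf bg j; exact: bmfD. Qed.

Lemma bfamB f g : bounded_family f -> bounded_family g ->
  bounded_family (fun j x => f j x - g j x).
Proof. by move=> bf bg j; exact: bmfB. Qed.

Lemma bfamM f g : bounded_family f -> bounded_family g ->
  bounded_family (fun j x => f j x * g j x).
Proof. by move=> bf bg j; exact: bmfM. Qed.

Lemma bfamZ c f : bounded_family f -> bounded_family (fun j x => c * f j x).
Proof. by move=> bf j; exact: bmfZ. Qed.

Lemma bfam_norm f : bounded_family f -> bounded_family (fun j x => `|f j x|).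
Proof. by move=> bf j; exact: bmf_norm. Qed.

Lemma bfam_cst c : bounded_family (fun _ _ => c).
Proof. by move=> j; exact: bmf_cst. Qed.

Lemma bfam_sum I (s : seq I) (F : I -> A -> X -> R) :
  (forall i, bounded_family (F i)) ->
  bounded_family (fun j x => \sum_(i <- s) F i j x).
Proof. by move=> bF j; apply: bmf_sum => i; exact: bF. Qed.

Lemma expectD f g : bounded_family f -> bounded_family g ->
  expect (fun j x => f j x + g j x) = expect f + expect g.
Proof.
move=> bf bg; rewrite /expect -big_split /=; apply: eq_bigr => j _.
by rewrite -mulrDr meanD.
Qed.

Lemma expectZ c f : bounded_family f ->
  expect (fun j x => c * f j x) = c * expect f.
Proof.
move=> bf; rewrite /expect mulr_sumr; apply: eq_bigr => j _.
by rewrite meanZ// mulrCA.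
Qed.

Lemma expectB f g : bounded_family f -> bounded_family g ->
  expect (fun j x => f j x - g j x) = expect f - expect g.
Proof.
move=> bf bg; rewrite /expect -sumrB; apply: eq_bigr => j _.
by rewrite -mulrBr meanB.
Qed.

Lemma expect_cst c : expect (fun _ _ => c) = c.
Proof.
rewrite /expect; under eq_bigr do rewrite mean_cst.
by rewrite -mulr_suml (rc_p_sum C) mul1r.
Qed.

Lemma expect_sum I (s : seq I) (F : I -> A -> X -> R) :
  (forall i, bounded_family (F i)) ->
  expect (fun j x => \sum_(i <- s) F i j x) = \sum_(i <- s) expect (F i).
Proof.
move=> bF; rewrite /expect exchange_big; apply: eq_bigr => j _.
by rewrite mean_sum ?mulr_sumr// => i; exact: bF.
Qed.

Lemma expect_le f g : bounded_family f -> bounded_family g ->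
  (forall j x, f j x <= g j x) -> expect f <= expect g.
Proof.
move=> bf bg fg; apply: ler_sum => j _; rewrite ler_pM2l ?(rc_p_gt0 C)//.
exact: mean_le.
Qed.

Lemma expect_ge0 f : (forall j x, 0 <= f j x) -> 0 <= expect f.
Proof.
move=> f0; apply: sumr_ge0 => j _; rewrite mulr_ge0 ?(ltW (rc_p_gt0 C j))//.
exact: mean_ge0.
Qed.

Lemma mean_le_expect f j : bounded_family f -> (forall j x, 0 <= f j x) ->
  p j * mean nu (f j) <= expect f.
Proof.
move=> bf f0; rewrite /expect (bigD1 j)//= lerDl sumr_ge0// => i _.
by rewrite mulr_ge0 ?(ltW (rc_p_gt0 C i))// mean_ge0.
Qed.

Lemma mean_tau j (h : X -> R) : bounded_mfun h ->
  mean nu (fun x => h (tau j x)) = mean nu h.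
Proof. by move=> bh; apply: mean_comp => //;
  [exact: rc_measurable C j | exact: rc_preserving C j]. Qed.

Lemma tauKr j x : tau j (tau (opp j) x) = x.
Proof. by have := rc_tauK C (opp j) x; rewrite (rc_oppK C). Qed.

Lemma opp_bij : bijective opp.
Proof. by exists opp; exact: (rc_oppK C). Qed.

Lemma rc_stationary i : \sum_j p j * q j i = p i.
Proof.
under eq_bigr do rewrite (rc_reversible C).
rewrite -mulr_sumr -[RHS]mulr1 -(rc_q_sum C (opp i)); congr (_ * _).
by rewrite [RHS](reindex opp) //; apply: onW_bij; exact: opp_bij.
Qed.

Lemma expect_flip f : bounded_family f -> expect (flip f) = expect f.
Proof.
move=> bf; rewrite /expect [RHS](reindex opp) /=; last first.
  by apply: onW_bij; exact: opp_bij.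
by apply: eq_bigr => j _; rewrite mean_tau// (rc_p_opp C).
Qed.

Lemma flipK f : flip (flip f) = f.
Proof.
by apply/funext => j; apply/funext => x; rewrite /flip (rc_oppK C) (rc_tauK C).
Qed.

Lemma mean_step f j : bounded_family f ->
  mean nu (step f j) = \sum_i q j i * mean nu (f i).
Proof.
move=> bf; have bft i : bounded_mfun (fun x => f i (tau j x)).
  by apply: (bmf_comp (f := f i)); [exact: rc_measurable C j|exact: bf].
rewrite /step mean_sum => [|i]; last exact: bmfZ.
by apply: eq_bigr => i _; rewrite meanZ// mean_tau.
Qed.

Lemma expect_step f : bounded_family f -> expect (step f) = expect f.
Proof.
move=> bf; rewrite /expect; under eq_bigr do rewrite mean_step// mulr_sumr.
rewrite exchange_big; apply: eq_bigr => i _ /=.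
by under eq_bigr do rewrite mulrA; rewrite -mulr_suml rc_stationary.
Qed.

Lemma expect_iter n f : bounded_family f -> expect (iter n step f) = expect f.
Proof.
by move=> bf; elim: n => //= n <-; apply: expect_step; exact: bfam_iter.
Qed.

Lemma flip_step_flip g i x :
  flip (step (flip g)) i x = \sum_j q (opp i) (opp j) * g j (tau (opp j) x).
Proof.
rewrite /flip /step [LHS](reindex opp) /=; last exact/onW_bij/opp_bij.
by apply: eq_bigr => j _; rewrite (rc_oppK C) (rc_tauK C).
Qed.

(** The adjoint of [step] averages over the previous letters and moves x
    backwards along tau; reversibility identifies it with the conjugate of
    [step] by [flip]. *)
Lemma expect_step_adj f g : bounded_family f -> bounded_family g ->
  expect (fun j x => step f j x * g j x) =
  expect (fun j x => f j x * flip (step (flip g)) j x).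
Proof.
move=> bf bg.
have bft i j : bounded_mfun (fun x => f i (tau j x)).
  by apply: (bmf_comp (f := f i)); [exact: rc_measurable C j|exact: bf].
have bgt i j : bounded_mfun (fun x => g i (tau j x)).
  by apply: (bmf_comp (f := g i)); [exact: rc_measurable C j|exact: bg].
transitivity (\sum_j \sum_i p j * q j i *
    mean nu (fun x => f i (tau j x) * g j x)).
  apply: eq_bigr => j _; rewrite /step.
  under eq_fun do rewrite mulr_suml; rewrite mean_sum => [|i]; last first.
    by apply: bmfM => //; exact: bmfZ.
  rewrite mulr_sumr; apply: eq_bigr => i _; under eq_fun do rewrite -mulrA.
  by rewrite meanZ ?mulrA//; exact: bmfM.
rewrite exchange_big; apply: eq_bigr => i _ /=.
under [in RHS]eq_fun do rewrite flip_step_flip mulr_sumr.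
rewrite mean_sum => [|j]; last by apply: bmfM => //; exact: bmfZ.
rewrite mulr_sumr; apply: eq_bigr => j _; under [in RHS]eq_fun do rewrite mulrCA.
rewrite meanZ; last exact: bmfM.
rewrite mulrA -(rc_reversible C); congr (_ * _).
rewrite -(mean_tau (opp j)); last exact: bmfM.
by under eq_fun do rewrite tauKr.
Qed.

Lemma expect_iter_adj n f g : bounded_family f -> bounded_family g ->
  expect (fun j x => iter n step f j x * g j x) =
  expect (fun j x => f j x * flip (iter n step (flip g)) j x).
Proof.
move=> bf; elim: n g => [|n IHn] g bg /=; first by rewrite flipK.
rewrite expect_step_adj//; last exact: bfam_iter.
rewrite IHn; last exact/bfam_flip/bfam_step/bfam_flip.
by rewrite flipK -iterSr.
Qed.

Lemma expect_flipM f g : bounded_family f -> bounded_family g ->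
  expect (fun j x => flip f j x * flip g j x) =
  expect (fun j x => f j x * g j x).
Proof. by move=> bf bg; rewrite -[RHS]expect_flip//; exact: bfamM. Qed.

Lemma stepD f g :
  step (fun j x => f j x + g j x) = fun j x => step f j x + step g j x.
Proof.
apply/funext => j; apply/funext => x; rewrite /step -big_split /=.
by apply: eq_bigr => i _; rewrite mulrDr.
Qed.

Lemma stepZ c f : step (fun j x => c * f j x) = fun j x => c * step f j x.
Proof.
apply/funext => j; apply/funext => x; rewrite /step mulr_sumr.
by apply: eq_bigr => i _; rewrite mulrCA.
Qed.

Lemma stepB f g :
  step (fun j x => f j x - g j x) = fun j x => step f j x - step g j x.
Proof.
apply/funext => j; apply/funext => x; rewrite /step -sumrB.
by apply: eq_bigr => i _; rewrite mulrBr.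
Qed.

Lemma step_cst c : step (fun _ _ => c) = fun _ _ => c.
Proof.
apply/funext => j; apply/funext => x.
by rewrite /step -mulr_suml (rc_q_sum C) mul1r.
Qed.

Lemma step_le f g : (forall j x, f j x <= g j x) ->
  forall j x, step f j x <= step g j x.
Proof.
by move=> fg j x; apply: ler_sum => i _; rewrite ler_wpM2l// (rc_q_ge0 C).
Qed.

Lemma iter_stepD n f g : iter n step (fun j x => f j x + g j x) =
  fun j x => iter n step f j x + iter n step g j x.
Proof. by elim: n => //= n ->; rewrite stepD. Qed.

Lemma iter_stepB n f g : iter n step (fun j x => f j x - g j x) =
  fun j x => iter n step f j x - iter n step g j x.
Proof. by elim: n => //= n ->; rewrite stepB. Qed.

Lemma iter_stepZ n c f :
  iter n step (fun j x => c * f j x) = fun j x => c * iter n step f j x.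
Proof. by elim: n => //= n ->; rewrite stepZ. Qed.

Lemma iter_step_cst n c : iter n step (fun _ _ => c) = fun _ _ => c.
Proof. by elim: n => //= n ->; rewrite step_cst. Qed.

Lemma iter_step_le n f g : (forall j x, f j x <= g j x) ->
  forall j x, iter n step f j x <= iter n step g j x.
Proof. by move=> fg; elim: n => //= n; exact: step_le. Qed.

Lemma iter_step_ge0 n f : (forall j x, 0 <= f j x) ->
  forall j x, 0 <= iter n step f j x.
Proof.
move=> f0 j x.
by rewrite -[leLHS](congr1 (fun g => g j x) (iter_step_cst n 0)) iter_step_le.
Qed.

Lemma norm_iter n f j x :
  `|iter n step f j x| <= iter n step (fun j x => `|f j x|) j x.
Proof.
elim: n j x => //= n IHn j x; rewrite /step.
apply: (le_trans (ler_norm_sum _ _ _)); apply: ler_sum => i _.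
by rewrite normrM (ger0_norm (rc_q_ge0 C j i)) ler_wpM2l// (rc_q_ge0 C).
Qed.

Lemma flipB f g :
  flip (fun j x => f j x - g j x) = fun j x => flip f j x - flip g j x.
Proof. by []. Qed.

Lemma expect_norm_iter n f : bounded_family f ->
  expect (fun j x => `|iter n step f j x|) <= expect (fun j x => `|f j x|).
Proof.
move=> bf; rewrite -(expect_iter n (bfam_norm bf)); apply: expect_le.
- exact/bfam_norm/bfam_iter.
- exact/bfam_iter/bfam_norm.
- exact: norm_iter.
Qed.

Lemma expect_norm_flip f : bounded_family f ->
  expect (fun j x => `|flip f j x|) = expect (fun j x => `|f j x|).
Proof. by move=> bf; rewrite -[RHS]expect_flip//; exact: bfam_norm. Qed.

Lemma bfam_bound f : bounded_family f ->
  exists2 M, 0 <= M & forall j x, `|f j x| <= M.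
Proof.
move=> bf; have /choice[M fM] : forall j, exists M, forall x, `|f j x| <= M.
  by move=> j; case: (bf j).
exists (\sum_j `|M j|) => [|j x]; first exact: sumr_ge0.
rewrite (le_trans (fM j x))// (le_trans (ler_norm _))// (bigD1 j)//= lerDl.
exact: sumr_ge0.
Qed.

Lemma iter_step_bound n f M : (forall j x, `|f j x| <= M) ->
  forall j x, `|iter n step f j x| <= M.
Proof.
move=> fM j x; apply: (le_trans (norm_iter _ _ _ _)).
by rewrite -[leRHS](congr1 (fun g => g j x) (iter_step_cst n M)) iter_step_le.
Qed.

End MarkovOperator.

(** * Asymptotic regularity and mean convergence *)

Section MeanSquare.
Context (d : measure_display) (X : measurableType d) (R : realType).
Variable nu : probability X R.

(** The variance of the absolute value is nonnegative. *)
Lemma mean_norm_sqr (g : X -> R) : bounded_mfun g ->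
  mean nu (fun x => `|g x|) ^+ 2 <= mean nu (fun x => g x ^+ 2).
Proof.
move=> bg; set c := mean nu _.
have bn : bounded_mfun (fun x => `|g x|) by exact: bmf_norm.
have : 0 <= mean nu (fun x => (`|g x| - c) ^+ 2).
  by apply: mean_ge0 => x; exact: sqr_ge0.
have -> : (fun x => (`|g x| - c) ^+ 2) =
    (fun x => (g x ^+ 2 - (2 * c) * `|g x|) + c ^+ 2).
  by apply/funext => x; rewrite sqrrB real_normK ?num_real//; ring.
rewrite meanD; [|exact: bmfB (bmfX _ bg) (bmfZ _ bn)|exact: bmf_cst].
rewrite meanB; [|exact: bmfX|exact: bmfZ].
by rewrite meanZ// mean_cst -/c; lra.
Qed.

Lemma mean_normD (f g : X -> R) : bounded_mfun f -> bounded_mfun g ->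
  mean nu (fun x => `|f x + g x|) <=
  mean nu (fun x => `|f x|) + mean nu (fun x => `|g x|).
Proof.
move=> bf bg; rewrite -meanD; try exact: bmf_norm.
apply: mean_le => [||x]; last exact: ler_normD.
  exact/bmf_norm/bmfD.
by apply: bmfD; exact: bmf_norm.
Qed.

Lemma mean_norm_triangle (f g h : X -> R) :
  bounded_mfun f -> bounded_mfun g -> bounded_mfun h ->
  mean nu (fun x => `|f x - h x|) <=
  mean nu (fun x => `|f x - g x|) + mean nu (fun x => `|g x - h x|).
Proof.
move=> bf bg bh; have := mean_normD (bmfB bf bg) (bmfB bg bh).
by under eq_fun do rewrite addrA subrK.
Qed.

Lemma mean_norm_sym (f g : X -> R) :
  mean nu (fun x => `|f x - g x|) = mean nu (fun x => `|g x - f x|).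
Proof. by under eq_fun do rewrite distrC. Qed.

Lemma cvg_mean_norm (g : nat -> X -> R) : (forall n, bounded_mfun (g n)) ->
  (fun n => mean nu (fun x => g n x ^+ 2)) @ \oo --> (0 : R) ->
  (fun n => mean nu (fun x => `|g n x|)) @ \oo --> (0 : R).
Proof.
move=> bg g0.
have s0 : (fun n => Num.sqrt (mean nu (fun x => g n x ^+ 2))) @ \oo --> (0 : R).
  by rewrite -sqrtr0; apply: continuous_cvg g0; exact: sqrt_continuous.
apply: (squeeze_cvgr _ (cvg_cst (0 : R)) s0); apply: nearW => n.
rewrite mean_ge0//= -[leLHS]ger0_norm ?mean_ge0// -sqrtr_sqr ler_sqrt.
  exact: mean_norm_sqr.
by apply: mean_ge0 => x; exact: sqr_ge0.
Qed.

End MeanSquare.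

Lemma cvg0_le (R : realType) (a b : nat -> R) :
  (forall n, 0 <= a n <= b n) -> b @ \oo --> 0 -> a @ \oo --> 0.
Proof.
by move=> ab b0; apply: (squeeze_cvgr _ (cvg_cst 0) b0); exact: nearW.
Qed.

Lemma cvg_sum_seq (R : realType) (I : Type) (s : seq I) (F : I -> nat -> R)
    (l : I -> R) : (forall i, F i @ \oo --> l i) ->
  (fun n => \sum_(i <- s) F i n) @ \oo --> \sum_(i <- s) l i.
Proof.
move=> Fl; elim: s => [|i s IHs].
  by under eq_fun do rewrite big_nil; rewrite big_nil; exact: cvg_cst.
by under eq_fun do rewrite big_cons; rewrite big_cons; exact: cvgD.
Qed.

Section AsymptoticRegularity.
Context (d : measure_display) (X : measurableType d) (R : realType).
Context (nu : probability X R) (A : finType) (opp : A -> A).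
Context (tau : A -> X -> X) (p : A -> R) (q : A -> A -> R).
Hypothesis C : reversible_chain nu opp tau p q.
Local Notation step := (step tau q).
Local Notation flip := (flip opp tau).
Local Notation expect := (expect nu p).
Implicit Types f g : A -> X -> R.

Definition energy f : R := expect (fun j x => f j x ^+ 2).

Lemma bfamX n f : bounded_family f -> bounded_family (fun j x => f j x ^+ n).
Proof. by move=> bf j; exact: bmfX. Qed.

Lemma bfam_tau f i j : bounded_family f -> bounded_mfun (fun x => f i (tau j x)).
Proof.
by move=> bf; apply: (bmf_comp (f := f i)); [exact: rc_measurable C j|exact: bf].
Qed.

(** The energy lost in one step is the mean conditional variance of the value
    of f after the jump. *)
Lemma energy_drop f : bounded_family f ->
  energy f - energy (step f) =
  expect (fun j x => \sum_i q j i * (f i (tau j x) - step f j x) ^+ 2).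
Proof.
move=> bf; have bf2 := bfamX 2 bf; have bs := bfam_step C bf.
rewrite /energy -(expect_step C bf2) -expectB//; last 2 first.
- exact: bfam_step C _ bf2.
- exact: bfamX.
congr (expect _); apply/funext => j; apply/funext => x.
set c := step f j x.
transitivity (\sum_i (q j i * f i (tau j x) ^+ 2 -
    ((2 * c) * (q j i * f i (tau j x)) - c ^+ 2 * q j i))).
  rewrite sumrB sumrB -!mulr_sumr (rc_q_sum C) -/(step f j x) -/c mulr1.
  by rewrite {1}/step; congr (_ - _); ring.
by apply: eq_bigr => i _; ring.
Qed.

Lemma deviation_le_energy_drop f i j : bounded_family f ->
  p j * q j i * mean nu (fun x => (f i (tau j x) - step f j x) ^+ 2) <=
  energy f - energy (step f).
Proof.
move=> bf; have bs := bfam_step C bf.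
have bD k : bounded_mfun (fun x => (f k (tau j x) - step f j x) ^+ 2).
  by apply: bmfX; apply: bmfB => //; exact: bfam_tau.
have t0 k l x : 0 <= q k l * (f l (tau k x) - step f k x) ^+ 2.
  by rewrite mulr_ge0 ?(rc_q_ge0 C)// sqr_ge0.
rewrite energy_drop//; apply: le_trans (mean_le_expect C j _ _); last 2 first.
- move=> k; apply: bmf_sum => l; apply: bmfZ; apply: bmfX.
  by apply: bmfB => //; exact: bfam_tau.
- by move=> k x; exact: sumr_ge0.
rewrite -mulrA ler_pM2l ?(rc_p_gt0 C)// -meanZ//; apply: mean_le.
- exact: bmfZ.
- by apply: bmf_sum => l; apply: bmfZ; apply: bmfX; apply: bmfB => //; exact: bfam_tau.
- by move=> x; rewrite [leRHS](bigD1 i)//= lerDl sumr_ge0.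
Qed.

Lemma energy_ge0 f : 0 <= energy f.
Proof. by apply: (expect_ge0 C) => j x; exact: sqr_ge0. Qed.

Lemma energy_step f : bounded_family f -> energy (step f) <= energy f.
Proof.
move=> bf; rewrite -subr_ge0 energy_drop//; apply: (expect_ge0 C) => j x.
by apply: sumr_ge0 => i _; rewrite mulr_ge0 ?(rc_q_ge0 C)// sqr_ge0.
Qed.

(** Provides the intermediate letters through which [regular] compares a
    backtracking letter and [step_flip_step] joins two letters. *)
Lemma other_letter (a b : A) : exists j, (j != a) && (j != b).
Proof.
apply/existsP; apply: contraT; rewrite negb_exists => /forallP ab.
have : (#|A| <= #|[set a; b]%SET|)%N.
  apply/subset_leq_card/fintype.subsetP => j _; rewrite !inE.
  by have := ab j; rewrite negb_and !negbK.
rewrite cards2 => le2; have := leq_trans (rc_card C) le2.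
by case: (a != b).
Qed.

Variable f : A -> X -> R.
Hypothesis bf : bounded_family f.
Local Notation u := (fun n => iter n step f).

Let bu n : bounded_family (u n). Proof. exact: bfam_iter C n _ bf. Qed.

Lemma energy_cvg : cvgn (fun n => energy (u n)).
Proof.
apply: nonincreasing_is_cvgn.
  by apply/nonincreasing_seqP => n; exact: energy_step (bu n).
by exists 0 => _ [n _ <-]; exact: energy_ge0.
Qed.

Lemma energy_drop_cvg : (fun n => energy (u n) - energy (u n.+1)) @ \oo --> 0.
Proof.
have e := energy_cvg; rewrite -(subrr (limn (fun n => energy (u n)))).
by apply: cvgB => //; have := e; rewrite -(cvg_shiftS (fun n => energy (u n))).
Qed.

Lemma regular_neq i j : i != opp j ->
  (fun n => mean nu (fun x => `|u n i (tau j x) - u n.+1 j x|)) @ \oo --> (0 : R).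
Proof.
move=> ij; have pq : 0 < p j * q j i.
  by rewrite mulr_gt0 ?(rc_p_gt0 C) ?(rc_q_gt0 C).
apply: (cvg_mean_norm (g := fun n x => u n i (tau j x) - u n.+1 j x)) => [n|].
  by apply: bmfB; [exact: bfam_tau (bu n) | exact: bu n.+1 j].
apply: (@cvg0_le _ _ (fun n => (p j * q j i)^-1 *
    (energy (u n) - energy (u n.+1)))) => [n|].
  rewrite mean_ge0 => [/=|x]; last exact: sqr_ge0.
  by rewrite ler_pdivlMl//; exact: (deviation_le_energy_drop i j (bu n)).
rewrite -[X in _ --> X](mulr0 (p j * q j i)^-1).
by apply: cvgM; [exact: cvg_cst | exact: energy_drop_cvg].
Qed.

(** The conditional variances vanish in the limit.  This compares the letters
    that can follow j with the step at j; the letter opp j cannot follow j, and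
    it is compared first with another letter k, at a letter l' which both may
    follow. *)
Lemma regular i j :
  (fun n => mean nu (fun x => `|u n i (tau j x) - u n.+1 j x|)) @ \oo --> (0 : R).
Proof.
have [-> {i}|] := eqVneq i (opp j); last exact: regular_neq.
have [k /andP[kj _]] := other_letter (opp j) (opp j).
(* Both opp j and k may follow l'. *)
have [l' /andP[]] := other_letter (opp (opp j)) (opp k).
set i := opp j => lj lk.
have il : i != opp l' by apply: contraNneq lj => ->; rewrite (rc_oppK C).
have kl : k != opp l' by apply: contraNneq lk => ->; rewrite (rc_oppK C).
have s0 : (fun n => mean nu (fun x => `|u n i (tau l' x) - u n.+1 l' x|) +
    mean nu (fun x => `|u n k (tau l' x) - u n.+1 l' x|) +
    mean nu (fun x => `|u n k (tau j x) - u n.+1 j x|)) @ \oo --> (0 : R).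
  rewrite -[X in _ --> X](addr0 (0 : R)) -[X in _ --> X + _](addr0 (0 : R)).
  by apply: cvgD; [apply: cvgD|]; exact: regular_neq.
apply: (cvg0_le _ s0) => n; rewrite mean_ge0//=.
apply: (le_trans (mean_norm_triangle nu (g := fun x => u n k (tau j x)) _ _ _)).
- exact: bfam_tau (bu n).
- exact: bfam_tau (bu n).
- exact: bu n.+1 j.
rewrite lerD2r.
have bd : bounded_mfun (fun x => `|u n i x - u n k x|).
  by apply/bmf_norm/bmfB; exact: bu n _.
rewrite (mean_tau C j bd) -(mean_tau C l' bd).
rewrite [X in _ + X](mean_norm_sym nu).
apply: (mean_norm_triangle nu (g := u n.+1 l')).
- exact: bfam_tau (bu n).
- exact: bu n.+1 l'.
- exact: bfam_tau (bu n).
Qed.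

Lemma flip_regular :
  (fun n => expect (fun j x => `|flip (u n) j x - u n.+1 j x|)) @ \oo --> (0 : R).
Proof.
have -> : (0 : R) = \sum_(j : A) p j * 0 by rewrite -mulr_suml mulr0.
apply: cvg_sum_seq => j; apply: cvgM; first exact: cvg_cst.
exact: regular.
Qed.

(** Applying two letters a, b moves the index by two, up to an error that
    vanishes in mean; so does applying opp a and then a, which is the identity.
    Hence applying a, b also acts as the identity in the limit. *)
Lemma regular2 a b i i' :
  (fun n => mean nu (fun x => `|u n i (tau b (tau a x)) - u n i' x|)) @ \oo
    --> (0 : R).
Proof.
have s0 : (fun n => (mean nu (fun x => `|u n i (tau b x) - u n.+1 b x|) +
    mean nu (fun x => `|u n.+1 b (tau a x) - u n.+2 a x|)) +
    (mean nu (fun x => `|u n i' (tau (opp a) x) - u n.+1 (opp a) x|) +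
     mean nu (fun x => `|u n.+1 (opp a) (tau a x) - u n.+2 a x|))) @ \oo
   --> (0 : R).
  have := regular b a; rewrite -cvg_shiftS => rba.
  have := regular (opp a) a; rewrite -cvg_shiftS => raa.
  rewrite -[X in _ --> X](addr0 (0 : R)).
  by apply: cvgD; rewrite -[X in _ --> X](addr0 (0 : R)); apply: cvgD => //;
    exact: regular.
apply: (cvg0_le _ s0) => n; rewrite mean_ge0//=.
have b1 := bfam_tau b a (bu n.+1); have b2 := bfam_tau i' (opp a) (bu n).
have b3 := bfam_tau (opp a) a (bu n.+1); have b4 := bu n.+2 a.
have b5 : bounded_mfun (fun x => u n i (tau b (tau a x))).
  apply: (bmf_comp (f := fun x => u n i (tau b x))); last exact: bfam_tau (bu n).
  exact: rc_measurable C a.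
apply: (le_trans (mean_norm_triangle nu b5 b4 (bu n i'))); apply: lerD.
  apply: (le_trans (mean_norm_triangle nu b5 b1 b4)); rewrite lerD2r.
  rewrite (mean_tau C a (h := fun x => `|u n i (tau b x) - u n.+1 b x|))//.
  by apply/bmf_norm/bmfB; [exact: bfam_tau (bu n) | exact: bu n.+1 b].
rewrite (mean_norm_sym nu).
apply: (le_trans (mean_norm_triangle nu (bu n i') b3 b4)); rewrite lerD2r.
rewrite -(mean_tau C a (h := fun x => `|u n i' (tau (opp a) x) - _|)).
  apply: mean_le => [||x]; last by rewrite (rc_tauK C).
    by apply/bmf_norm/bmfB; [exact: bu n i' | exact: b3].
  apply: (bmf_comp (f := fun x => `|u n i' (tau (opp a) x) - u n.+1 (opp a) x|)).
    exact: rc_measurable C a.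
  by apply/bmf_norm/bmfB; [exact: b2 | exact: bu n.+1 (opp a)].
by apply/bmf_norm/bmfB; [exact: b2 | exact: bu n.+1 (opp a)].
Qed.

(** Half of the difference of the two exponents is moved from one factor to
    the other, so that both sides perform n + k steps. *)
Lemma cross_energy n k : (k <= n)%N ->
  expect (fun j x => u n.*2 j x * u k.*2 j x) =
  expect (fun j x => u (n + k)%N j x * flip (iter (n - k) step (flip (u k.*2))) j x).
Proof.
move=> kn; rewrite -(expect_iter_adj C (n - k) (bu (n + k)) (bu k.*2)) -iterD.
by have -> : (n - k + (n + k))%N = n.*2 by lia.
Qed.

Lemma energyB f1 f2 : bounded_family f1 -> bounded_family f2 ->
  energy (fun j x => f1 j x - f2 j x) =
  energy f1 + energy f2 - 2 * expect (fun j x => f1 j x * f2 j x).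
Proof.
move=> b1 b2; rewrite /energy -expectZ; last exact: bfamM.
rewrite -expectD; try exact: bfamX.
rewrite -expectB; last 2 first.
- by apply: bfamD; exact: bfamX.
- exact/bfamZ/bfamM.
by congr (expect _); apply/funext => j; apply/funext => x; ring.
Qed.

(** By [cross_energy] the inner product of the iterates of orders 2n and 2k
    pairs the iterate of order n + k with an alternation of steps and flips
    that [flip_regular] compares, twice, with this same iterate.  All the
    energies being close to their limit, the energy of the difference is
    small. *)
Lemma cauchy_energy e : 0 < e -> exists N, forall n k, (N <= k)%N -> (k <= n)%N ->
  energy (fun j x => u n.*2 j x - u k.*2 j x) <= e.
Proof.
move=> e0; have [M M0 fM] := bfam_bound bf.
pose eta n := expect (fun j x => `|flip (u n) j x - u n.+1 j x|).
set L := limn (fun n => energy (u n)).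
have M1 : 0 < M + 1 by lra.
have e1 : 0 < e / 8 / (M + 1) by rewrite !divr_gt0.
have e8 : 0 < e / 8 by rewrite divr_gt0.
have /cvgrPdist_le /(_ _ e8) [N1 _ hN1] : (fun n => energy (u n)) @ \oo --> L.
  exact: energy_cvg.
have /cvgr0Pnorm_le /(_ _ e1) [N2 _ hN2] : eta @ \oo --> (0 : R).
  exact: flip_regular.
exists (N1 + N2)%N => n k Nk kn.
rewrite energyB; [|exact: bu n.*2|exact: bu k.*2].
rewrite cross_energy//.
set w := flip _.
have bw : bounded_family w.
  exact/(bfam_flip C)/(bfam_iter C)/(bfam_flip C)/bu.
have hL m : (N1 <= m)%N -> `|L - energy (u m)| <= e / 8 by exact: hN1.
have h1 : `|L - energy (u n.*2)| <= e / 8 by apply: hL; lia.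
have h2 : `|L - energy (u k.*2)| <= e / 8 by apply: hL; lia.
have h3 : `|L - energy (u (n + k)%N)| <= e / 8 by apply: hL; lia.
have he m : (N2 <= m)%N -> eta m <= e / 8 / (M + 1).
  by move=> Nm; apply: le_trans (hN2 m Nm); exact: ler_norm.
have g1 : eta k.*2 <= e / 8 / (M + 1) by apply: he; lia.
have g2 : eta (n + k)%N <= e / 8 / (M + 1) by apply: he; lia.
(* w arises from the 2k-th iterate by n - k steps between two flips; replacing
   the inner flip by a step costs the first error, and replacing the outer one
   by the removal of a step costs the second. *)
have wu : expect (fun j x => `|w j x - u (n + k)%N j x|) <=
    eta k.*2 + eta (n + k)%N.
  have b1 : bounded_family (fun j x => flip (u k.*2) j x - u k.*2.+1 j x).
    by apply: bfamB; [exact: bfam_flip C _ (bu _) | exact: bu k.*2.+1].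
  have b2 : bounded_family (fun j x => flip (u (n + k)) j x - u (n + k).+1 j x).
    by apply: bfamB; [exact: bfam_flip C _ (bu _) | exact: bu (n + k).+1].
  have -> : (fun j x => `|w j x - u (n + k)%N j x|) =
     fun j x => `|flip (iter (n - k) step
       (fun j x => flip (u k.*2) j x - u k.*2.+1 j x)) j x -
       flip (fun j x => flip (u (n + k)) j x - u (n + k).+1 j x) j x|.
    apply/funext => j; apply/funext => x; congr (`|_|).
    rewrite iter_stepB !flipB (flipK C) -iterD.
    have -> : (n - k + k.*2.+1)%N = (n + k).+1 by lia.
    by rewrite /w; ring.
  have bi := bfam_flip C (bfam_iter C (n - k) b1).
  have bg := bfam_flip C b2.
  apply: (@le_trans _ _ (expect (fun j x =>
      `|flip (iter (n - k) step
       (fun j x => flip (u k.*2) j x - u k.*2.+1 j x)) j x| +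
      `|flip (fun j x => flip (u (n + k)) j x - u (n + k).+1 j x) j x|))).
    apply: (expect_le C) => [||j x].
    - exact/bfam_norm/bfamB.
    - by apply: bfamD; exact: bfam_norm.
    - exact: ler_normB.
  rewrite expectD; try exact: bfam_norm.
  rewrite !(expect_norm_flip C)//; last exact: (bfam_iter C).
  by rewrite lerD2r; exact: (expect_norm_iter C).
have : energy (u (n + k)%N) - expect (fun j x => u (n + k)%N j x * w j x) <=
    M * expect (fun j x => `|w j x - u (n + k)%N j x|).
  have bW := bfamB bw (bu (n + k)).
  rewrite /energy -expectB; last 2 first.
  - exact/bfamX/bu.
  - exact: bfamM (bu _) bw.
  rewrite -expectZ; last exact: bfam_norm.
  apply: (expect_le C) => [||j x].
  - by apply: bfamB; [exact/bfamX/bu | exact: bfamM (bu _) bw].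
  - exact/bfamZ/bfam_norm.
  - rewrite expr2 -mulrBr (le_trans (ler_norm _))// normrM distrC.
    by rewrite ler_wpM2r// (iter_step_bound C).
have : M * expect (fun j x => `|w j x - u (n + k)%N j x|) <= e / 4.
  apply: (@le_trans _ _ (M * (e / 8 / (M + 1) + e / 8 / (M + 1)))).
    by rewrite ler_wpM2l// (le_trans wu)// lerD.
  rewrite -[leRHS]mulr1.
  have -> : M * (e / 8 / (M + 1) + e / 8 / (M + 1)) = e / 4 * (M / (M + 1)).
    by field; lra.
  by rewrite ler_wpM2l ?divr_ge0 ?(ltW e0)// ler_pdivrMr// mul1r; lra.
move: h1 h2 h3; rewrite !ler_norml => /andP[? ?] /andP[? ?] /andP[? ?].
lra.
Qed.

End AsymptoticRegularity.

(** * The entropy maximal inequality *)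

Section RelativeEntropy.
Variable R : realType.
Implicit Types x s b : R.

(** The integrand of the generalized relative entropy, which is nonnegative and
    jointly convex. *)
Definition relent x s : R := x * (ln x - ln s) - x + s.

Lemma log_tangent x s : 0 < x -> 0 < s -> x * (ln s - ln x) <= s - x.
Proof.
move=> x0 s0; rewrite -ln_div ?posrE//.
have sx0 : 0 < s / x by rewrite divr_gt0.
have /= := @le_ln1Dx R (s / x - 1); rewrite addrCA subrr addr0 => H.
have -> : s - x = x * (s / x - 1) by field; exact: lt0r_neq0.
by rewrite ler_pM2l// H//; lra.
Qed.

Lemma relent_ge0 x s : 0 < x -> 0 < s -> 0 <= relent x s.
Proof. by move=> x0 s0; have := log_tangent x0 s0; rewrite /relent; lra. Qed.

(** The derivative of [relent x] at s is 1 - x / s, at most 1 - x / 2 as long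
    as s does not exceed 2; this is where the bound by 1 on the total weight is
    used. *)
Lemma relent_budget x s b : 0 <= x -> 1 <= s -> 0 <= b -> s + b <= 2 ->
  x * b <= 2 * (relent x s - relent x (s + b)) + 2 * b.
Proof.
move=> x0 s1 b0 sb; have := @log_tangent (s + b) s; rewrite /relent => H.
have {}H : (s + b) * (ln s - ln (s + b)) <= s - (s + b) by apply: H; lra.
set L := ln (s + b) - ln s.
have L0 : 0 <= L by rewrite subr_ge0 ler_ln ?posrE; lra.
have : b <= 2 * L.
  have : (s + b) * L <= 2 * L by rewrite ler_wpM2r.
  by move: H; rewrite /L; lra.
by move/(ler_wpM2l x0); rewrite /L; lra.
Qed.

(** The log-sum inequality: [relent] lies above its tangent planes. *)
Lemma relent_jensen (I : finType) (w x s : I -> R) :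
  (forall i, 0 <= w i) -> \sum_i w i = 1 ->
  (forall i, 1 <= x i) -> (forall i, 1 <= s i) ->
  relent (\sum_i w i * x i) (\sum_i w i * s i) <= \sum_i w i * relent (x i) (s i).
Proof.
move=> w0 w1 x1 s1.
have avg1 (y : I -> R) : (forall i, 1 <= y i) -> 1 <= \sum_i w i * y i.
  move=> y1; rewrite -[leLHS]w1; apply: ler_sum => i _.
  by rewrite -[leLHS]mulr1 ler_wpM2l.
set xb := \sum_i w i * x i; set sb := \sum_i w i * s i.
have xb1 : 1 <= xb by exact: avg1.
have sb1 : 1 <= sb by exact: avg1.
have sb0 : 0 < sb by lra.
apply: (@le_trans _ _ (\sum_i w i * (x i * (ln xb - ln sb) -
    s i * (xb / sb) + s i))).
  under eq_bigr do rewrite mulrDr mulrBr !mulrA.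
  rewrite big_split sumrB /= -!mulr_suml -/xb -/sb.
  suff -> : sb * xb / sb = xb by rewrite /relent; lra.
  by field; exact: lt0r_neq0.
apply: ler_sum => i _; apply: ler_wpM2l => //.
have xi := x1 i; have si := s1 i; rewrite /relent.
have := @log_tangent (x i * sb) (s i * xb); rewrite !lnM ?posrE; try lra.
have p1 : 0 < x i * sb by rewrite mulr_gt0//; lra.
have p2 : 0 < s i * xb by rewrite mulr_gt0//; lra.
move=> /(_ p1 p2); set a := (ln _ + _ - _) => H.
have : x i * a <= s i * (xb / sb) - x i.
  rewrite -(ler_pM2l sb0).
  have -> : sb * (s i * (xb / sb) - x i) = s i * xb - x i * sb.
    by field; exact: lt0r_neq0.
  by rewrite mulrA (mulrC sb).
by rewrite /a; lra.
Qed.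

Lemma relent_1Dx_le x : 0 <= x -> relent (1 + x) 1 <= x * ln (1 + x).
Proof.
move=> x0; rewrite /relent ln1; have := @le_ln1Dx R x.
by move=> H; have : ln (1 + x) <= x by [apply: H; lra]; lra.
Qed.

End RelativeEntropy.

Section MaximalInequality.
Context (d : measure_display) (X : measurableType d) (R : realType).
Context (nu : probability X R) (A : finType) (opp : A -> A).
Context (tau : A -> X -> X) (p : A -> R) (q : A -> A -> R).
Hypothesis C : reversible_chain nu opp tau p q.
Local Notation step := (step tau q).
Local Notation flip := (flip opp tau).
Local Notation expect := (expect nu p).
Implicit Types f g h s : A -> X -> R.

Lemma bmf_ln (h : X -> R) : bounded_mfun h -> (forall x, 1 <= h x) ->
  bounded_mfun (fun x => ln (h x)).
Proof.
move=> [mh [M hM]] h1; split.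
  by apply: measurableT_comp => //; exact: measurable_ln.
exists M => x; rewrite ger0_norm ?ln_ge0//.
apply: le_trans (hM x); apply: le_trans (ler_norm _).
by apply/ltW/ln_sublinear/(lt_le_trans _ (h1 x)).
Qed.

Lemma bfam_relent f s : bounded_family f -> bounded_family s ->
  (forall j x, 1 <= f j x) -> (forall j x, 1 <= s j x) ->
  bounded_family (fun j x => relent (f j x) (s j x)).
Proof.
move=> bf bs f1 s1 j; apply: bmfD => //; apply: bmfB => //.
by apply: bmfM => //; apply: bmfB; exact: bmf_ln.
Qed.

Lemma iter_step_ge1 n f : (forall j x, 1 <= f j x) ->
  forall j x, 1 <= iter n step f j x.
Proof.
move=> f1 j x.
by rewrite -[leLHS](congr1 (fun g => g j x) (iter_step_cst C n 1)) (iter_step_le C).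
Qed.

Lemma expect_relent_step f s : bounded_family f -> bounded_family s ->
  (forall j x, 1 <= f j x) -> (forall j x, 1 <= s j x) ->
  expect (fun j x => relent (step f j x) (step s j x)) <=
  expect (fun j x => relent (f j x) (s j x)).
Proof.
move=> bf bs f1 s1; have br := bfam_relent bf bs f1 s1.
rewrite -[leRHS](expect_step C br); apply: (expect_le C) => [||j x].
- apply: bfam_relent; try exact: bfam_step C _ _.
  + exact: (iter_step_ge1 1 f1).
  + exact: (iter_step_ge1 1 s1).
- exact: bfam_step C _ br.
- by apply: relent_jensen => // [i|]; [exact: rc_q_ge0 C j i | exact: rc_q_sum C j].
Qed.

Section Budget.
Variable b : nat -> A -> X -> R.
Hypothesis bb : forall n, bounded_family (b n).
Hypothesis b0 : forall n j x, 0 <= b n j x.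
Hypothesis b1 : forall n j x, \sum_(0 <= k < n) b k j x <= 1.

(** The potential compares the iterate of f with the iterate of one plus the
    weight already spent.  Spending the weight b_n pays for the n-th pairing by
    [relent_budget], and one more step does not increase the potential by
    [relent_jensen]. *)
Lemma entropy_telescope f n : bounded_family f -> (forall j x, 1 <= f j x) ->
  \sum_(0 <= k < n) expect (fun j x => iter k step f j x * iter k step (b k) j x)
  + 2 * expect (fun j x => relent (iter n step f j x)
      (iter n step (fun j x => 1 + \sum_(0 <= k < n) b k j x) j x))
  <= 2 * expect (fun j x => relent (f j x) 1)
     + 2 * \sum_(0 <= k < n) expect (b k).
Proof.
move=> bf f1.
(* The weight spent before time n, plus one. *)
pose S n := fun j x => 1 + \sum_(0 <= k < n) b k j x.
have bS m : bounded_family (S m).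
  by apply: bfamD; [exact: bfam_cst | exact: bfam_sum].
have S1 m j x : 1 <= S m j x by rewrite /S lerDl sumr_ge0.
elim: n => [|n IHn].
  rewrite !big_nil mulr0 addr0 add0r /=.
  have -> : (fun j x => relent (f j x) (1 + \sum_(0 <= k < 0) b k j x)) =
      (fun j x => relent (f j x) 1).
    by apply/funext => j; apply/funext => x; rewrite big_nil addr0.
  by [].
rewrite !big_nat_recr//=.
set F := iter n step f; set B := iter n step (b n).
set T := iter n step (S n).
have TB : iter n step (S n.+1) = fun j x => T j x + B j x.
  rewrite /T /B -iter_stepD; congr (iter _ _ _).
  by apply/funext => j; apply/funext => x; rewrite /S big_nat_recr//= addrA.
have bF : bounded_family F by exact: bfam_iter C n _ bf.
have bB : bounded_family B by exact: bfam_iter C n _ (bb n).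
have bT : bounded_family T by exact: bfam_iter C n _ (bS n).
have F1 j x : 1 <= F j x by exact: iter_step_ge1.
have T1 j x : 1 <= T j x by apply: iter_step_ge1; exact: S1.
have B0 j x : 0 <= B j x by apply: (iter_step_ge0 C); exact: b0.
have TB1 j x : 1 <= T j x + B j x by have := T1 j x; have := B0 j x; lra.
have TB2 j x : T j x + B j x <= 2.
  rewrite -[leLHS](congr1 (fun g => g j x) TB).
  rewrite -[leRHS](congr1 (fun g => g j x) (iter_step_cst C n 2)).
  by apply: (iter_step_le C) => k y; rewrite /S; have := b1 n.+1 k y; lra.
have br := bfam_relent bF bT F1 T1.
have br' := bfam_relent bF (bfamD bT bB) F1 TB1.
have key : expect (fun j x => F j x * B j x) +
    2 * expect (fun j x => relent (F j x) (T j x + B j x)) <=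
    2 * expect (fun j x => relent (F j x) (T j x)) + 2 * expect (b n).
  rewrite -(expect_iter C n (bb n)) -/B -!expectZ//.
  rewrite -!expectD//; try exact: bfamZ; try exact: bfamM.
  apply: (expect_le C) => [||j x].
  - by apply: bfamD; [exact: bfamM | exact: bfamZ].
  - by apply: bfamD; exact: bfamZ.
  - have := @relent_budget R (F j x) (T j x) (B j x).
    move=> H; have Fx := F1 j x; have {}H := H _ (T1 j x) (B0 j x) (TB2 j x).
    by have := H ltac:(lra); lra.
have mono := expect_relent_step bF (bfamD bT bB) F1 TB1.
have IH : \sum_(0 <= k < n)
    expect (fun j x => iter k step f j x * iter k step (b k) j x)
  + 2 * expect (fun j x => relent (F j x) (T j x))
  <= 2 * expect (fun j x => relent (f j x) 1)
     + 2 * \sum_(0 <= k < n) expect (b k) := IHn.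
have -> : iter n step (fun j x => 1 + \sum_(0 <= k < n.+1) b k j x) =
  (fun j x => T j x + B j x) := TB.
by lra.
Qed.

Lemma sum_expect_budget n : \sum_(0 <= k < n) expect (b k) <= 1.
Proof.
rewrite -expect_sum// -[leRHS](expect_cst C 1).
by apply: (expect_le C) => //; [exact: bfam_sum | exact: bfam_cst].
Qed.

(** With f = 1 + lambda h all the logarithms are taken of numbers at least 1,
    and the initial potential has the order of lambda h log (1 + lambda h). *)
Lemma entropy_pairing h lambda n : bounded_family h ->
  (forall j x, 0 <= h j x) -> 0 < lambda ->
  lambda * \sum_(0 <= k < n)
    expect (fun j x => iter k step h j x * iter k step (b k) j x) <=
  2 * expect (fun j x => relent (1 + lambda * h j x) 1) + 1.
Proof.
move=> bh h0 l0; have bl : bounded_family (fun j x => 1 + lambda * h j x).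
  by apply: bfamD; [exact: bfam_cst | exact: bfamZ].
have l1 j x : 1 <= 1 + lambda * h j x by rewrite lerDl mulr_ge0// ltW.
have := entropy_telescope n bl l1; have := sum_expect_budget n.
set S := \sum_(0 <= k < n) expect (b k).
have -> : \sum_(0 <= k < n) expect (fun j x =>
    iter k step (fun j x => 1 + lambda * h j x) j x * iter k step (b k) j x) =
  S + lambda * \sum_(0 <= k < n)
    expect (fun j x => iter k step h j x * iter k step (b k) j x).
  rewrite mulr_sumr -big_split /=; apply: eq_bigr => k _.
  have bhk := bfam_iter C k bh; have bbk := bfam_iter C k (bb k).
  rewrite -[in RHS](expect_iter C k (bb k)) -expectZ; last exact: bfamM.
  rewrite -expectD//; last exact/bfamZ/bfamM.
  congr (expect _); apply/funext => j; apply/funext => x.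
  by rewrite iter_stepD (iter_step_cst C) iter_stepZ; ring.
set E := expect (fun j x => relent (iter n _ _ _ _) _).
have : 0 <= E.
  apply: (expect_ge0 C) => j x; apply: relent_ge0.
    by apply: lt_le_trans (iter_step_ge1 n l1 j x).
  apply: lt_le_trans (iter_step_ge1 n _ j x) => // k y.
  by rewrite lerDl sumr_ge0.
by lra.
Qed.

End Budget.

(** A step, a flip and a step lead from the letter j to any letter i through an
    intermediate letter k, while x undergoes the transformation of j followed
    by that of k and its inverse; a single step reaches fewer letters i, at the
    same point. *)
Lemma step_flip_step : exists2 c : R, 0 < c & forall f,
  (forall j x, 0 <= f j x) ->
  forall j x, c * step f j x <= step (flip (step f)) j x.
Proof.
(* The probability of reaching i from j through some intermediate letter. *)
pose w j i := \sum_k q j k * q (opp k) i.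
have w0 j i : 0 < w j i.
  have [k /andP[kj ki]] := other_letter C (opp j) i.
  rewrite /w (bigD1 k)//= ltr_pwDl//; last first.
    by apply: sumr_ge0 => l _; rewrite mulr_ge0 ?(rc_q_ge0 C).
  rewrite mulr_gt0 ?(rc_q_gt0 C)//.
  by rewrite (rc_oppK C) eq_sym.
pose c := \big[Num.min/1]_(ji : A * A) w ji.1 ji.2.
have c0 : 0 < c by apply: lt_bigmin => // ji _; exact: w0.
exists c => // f f0 j x.
have -> : step (flip (step f)) j x = \sum_i w j i * f i (tau j x).
  rewrite /flip /step.
  under eq_bigr do rewrite mulr_sumr.
  rewrite exchange_big; apply: eq_bigr => i _ /=.
  by rewrite /w mulr_suml; apply: eq_bigr => k _; rewrite (rc_tauK C) mulrA.
rewrite /step mulr_sumr; apply: ler_sum => i _; rewrite mulrA ler_wpM2r//.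
have q1 : q j i <= 1.
  rewrite -(rc_q_sum C j) (bigD1 i)//= lerDl sumr_ge0// => k _.
  exact: rc_q_ge0 C j k.
apply: (@le_trans _ _ c); first by rewrite -[leRHS]mulr1 ler_wpM2l// ltW.
exact: (bigmin_le_cond _ (j := (j, i))).
Qed.

Fixpoint running_max (g : nat -> A -> X -> R) (n : nat) j x : R :=
  if n is k.+1 then Num.max (running_max g k j x) (g k j x) else 0.

Lemma running_maxS (g : nat -> A -> X -> R) n j x :
  running_max g n.+1 j x = Num.max (running_max g n j x) (g n j x).
Proof. by []. Qed.

Lemma bfam_running_max (g : nat -> A -> X -> R) n :
  (forall k, bounded_family (g k)) ->
  bounded_family (running_max g n).
Proof.
move=> bg j; elim: n => [|n IHn].
  exact: bmf_cst.
by apply: bmf_max => //; exact: bg.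
Qed.

(** Linearization of the maximum: b_k is the indicator of the set where the
    index k is the first to attain the maximum, when the latter is positive.
    The index n takes over the weight of the previous ones where it exceeds
    them. *)
Lemma running_max_selector (g : nat -> A -> X -> R) n :
  (forall k, bounded_family (g k)) ->
  exists b : nat -> A -> X -> R,
  [/\ forall k, bounded_family (b k), forall k j x, 0 <= b k j x,
      forall m j x, \sum_(0 <= k < m) b k j x <= 1,
      forall k, (n <= k)%N -> b k = fun _ _ => 0 &
      forall j x, running_max g n j x = \sum_(0 <= k < n) g k j x * b k j x].
Proof.
move=> bg; elim: n => [|n [b [bb b0 b1 bn be]]].
  exists (fun _ _ _ => 0); split => //.
  - by move=> k; exact: bfam_cst.
  - by move=> m j x; rewrite big1.
  - by move=> j x; rewrite big_nil.
pose B j x : bool := running_max g n j x < g n j x.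
have bB : bounded_family (fun j x => (B j x)%:R : R).
  move=> j; apply: bmf_indicator; apply: measurable_fun_ltr.
    exact: (bfam_running_max n bg j).1.
  exact: (bg n j).1.
have B01 j x : 0 <= (B j x)%:R :> R /\ (B j x)%:R <= 1 :> R.
  by case: (B j x); rewrite /= ?lexx ?ler01.
exists (fun k j x => (1 - (B j x)%:R) * b k j x + (k == n)%:R * (B j x)%:R); split.
- move=> k; apply: bfamD; last exact: bfamZ.
  by apply: bfamM => //; apply: bfamB => //; exact: bfam_cst.
- move=> k j x; have [B0 B1] := B01 j x.
  by rewrite addr_ge0 ?mulr_ge0 ?subr_ge0.
- move=> m j x; rewrite big_split /= -mulr_sumr -mulr_suml.
  have d1 : \sum_(0 <= k < m) (k == n)%:R <= 1 :> R.
    elim: m => [|m IHm]; first by rewrite big_nil ler01.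
    rewrite big_nat_recr//=; have [->|mn] := eqVneq m n; last by rewrite addr0.
    rewrite big_nat big1 ?add0r// => k /andP[_ kn].
    by rewrite (ltn_eqF kn).
  have := b1 m j x; case: (B j x); rewrite /=; lra.
- move=> k nk; apply/funext => j; apply/funext => x.
  by rewrite bn ?(ltnW nk)// (gtn_eqF nk) mul0r mulr0 addr0.
- move=> j x; rewrite running_maxS big_nat_recr//= bn// eqxx !mulr0 add0r.
  under eq_big_nat => k /andP[_ kn].
    rewrite (ltn_eqF kn) mul0r addr0 mulrCA; over.
  rewrite -mulr_sumr -be maxElt -/(B j x) mul1r.
  by case: (B j x); rewrite /=; ring.
Qed.

(** With the weights b_k of the selector, Q^(2k+2) h = Q^k Q Q^(k+1) h is at
    most 1/c times Q^(k+1) U Q^(k+2) h, where U is the flip.  Since U Q^(k+1) U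
    is the adjoint of Q^(k+1), pairing with b_k gives the pairing of
    Q^k (Q^2 h) with Q^k (Q U b_k), to which [entropy_pairing] applies.  The
    parameter lambda stays free so that for small h the term 1 can be made
    negligible after division by lambda. *)
Theorem entropy_maximal_inequality : exists2 c : R, 0 < c &
  forall h lambda n, bounded_family h -> (forall j x, 0 <= h j x) -> 0 < lambda ->
  c * lambda * expect (running_max (fun k => iter k.+1.*2 step h) n) <=
  1 + 2 * lambda * expect (fun j x => h j x * ln (1 + lambda * h j x)).
Proof.
have [c c0 Hc] := step_flip_step; exists c => // h lambda n bh h0 l0.
have bi k : bounded_family (iter k step h) by exact: bfam_iter C k _ bh.
have [b [bb b0 b1 _ be]] :=
  @running_max_selector (fun k => iter k.+1.*2 step h) n (fun k => bi _).
have -> : expect (running_max (fun k => iter k.+1.*2 step h) n) =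
    \sum_(0 <= k < n) expect (fun j x => iter k.+1.*2 step h j x * b k j x).
  rewrite -expect_sum; last by move=> k; exact: bfamM (bi _) (bb _).
  by congr (expect _); apply/funext => j; apply/funext => x; exact: be.
pose h2 := step (step h).
pose b' k := step (flip (b k)).
have bb' k : bounded_family (b' k) by exact/(bfam_step C)/(bfam_flip C).
have b'0 k j x : 0 <= b' k j x.
  by apply: (iter_step_ge0 C 1) => i y; exact: b0.
have b'1 m j x : \sum_(0 <= k < m) b' k j x <= 1.
  rewrite /b' /step exchange_big /= -(rc_q_sum C j); apply: ler_sum => i _.
  by rewrite -mulr_sumr -[leRHS]mulr1 ler_wpM2l ?(rc_q_ge0 C)//; exact: b1.
have bh2 : bounded_family h2 by exact: (bi 2).
have h20 j x : 0 <= h2 j x by exact: (iter_step_ge0 C 2).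
have pairing k : c * expect (fun j x => iter k.+1.*2 step h j x * b k j x) <=
    expect (fun j x => iter k step h2 j x * iter k step (b' k) j x).
  have bG : bounded_family (iter k.+2 step h) := bi _.
  apply: (@le_trans _ _ (expect (fun j x =>
      iter k.+1 step (flip (iter k.+2 step h)) j x * b k j x))).
    have bL := bfamM (bi k.+1.*2) (bb k).
    rewrite -expectZ//; apply: (expect_le C) => [||j x].
    - exact: bfamZ.
    - by apply: bfamM => //; exact/(bfam_iter C)/(bfam_flip C).
    rewrite mulrA ler_wpM2r//.
    have -> : iter k.+1.*2 step h = iter k step (step (iter k.+1 step h)).
      have -> : k.+1.*2 = (k + k.+2)%N by lia.
      by rewrite iterD.
    have -> : iter k.+1 step (flip (iter k.+2 step h)) =
      iter k step (step (flip (step (iter k.+1 step h)))) by rewrite iterSr.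
    set G := iter k.+1 step h.
    have G0 l z : 0 <= G l z by exact: (iter_step_ge0 C).
    have := iter_step_le C k (Hc G G0) j x.
    by rewrite iter_stepZ.
  rewrite (expect_iter_adj C)//; last exact: (bfam_flip C).
  rewrite (expect_flipM C)//; last first.
    exact/(bfam_iter C)/(bfam_flip C).
  by rewrite !iterSr.
rewrite (mulrC c) -[leLHS]mulrA [X in lambda * X]mulr_sumr.
have H2 : expect (fun j x => relent (1 + lambda * h2 j x) 1) <=
   expect (fun j x => h j x * ln (1 + lambda * h j x)) * lambda.
  have bl g : bounded_family g -> bounded_family (fun j x => 1 + lambda * g j x).
    by move=> bg; apply: bfamD; [exact: bfam_cst | exact: bfamZ].
  have l1 g : (forall j x, 0 <= g j x) -> forall j x, 1 <= 1 + lambda * g j x.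
    by move=> g0 j x; rewrite lerDl mulr_ge0// ltW.
  have decr g : bounded_family g -> (forall j x, 0 <= g j x) ->
      expect (fun j x => relent (1 + lambda * step g j x) 1) <=
      expect (fun j x => relent (1 + lambda * g j x) 1).
    move=> bg g0.
    have := expect_relent_step (bl g bg) (@bfam_cst _ _ _ _ 1) (l1 g g0)
      (fun _ _ => lexx 1).
    by rewrite stepD stepZ !(step_cst C).
  apply: (le_trans (decr _ (bi 1) (iter_step_ge0 C 1 h0))).
  apply: (le_trans (decr _ bh h0)).
  rewrite mulrC -expectZ; last first.
    by move=> j; apply: bmfM => //; apply: bmf_ln; [exact: bl | exact: l1].
  apply: (expect_le C) => [||j x].
  - apply: bfam_relent; [exact: bl|exact: bfam_cst|exact: l1|by []].
  - move=> j; apply: bmfZ; apply: bmfM => //.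
    by apply: bmf_ln; [exact: bl | exact: l1].
  - by rewrite mulrA; apply: relent_1Dx_le; rewrite mulr_ge0// ltW.
have := entropy_pairing bb' b'0 b'1 n bh2 h20 l0.
have : lambda * \sum_(0 <= k < n)
    c * expect (fun j x => iter k.+1.*2 step h j x * b k j x) <=
  lambda * \sum_(0 <= k < n)
    expect (fun j x => iter k step h2 j x * iter k step (b' k) j x).
  by rewrite ler_pM2l//; apply: ler_sum => k _; exact: pairing.
by lra.
Qed.

End MaximalInequality.

(** * Almost everywhere convergence *)

Lemma cvgn_of_approx (R : realType) (u : nat -> R) :
  (forall e, 0 < e -> exists l, \forall n \near \oo, `|l - u n| < e) -> cvgn u.
Proof. by move=> H; apply/cauchy_cvgP/cauchy_exP => e e0; exact: H. Qed.

Section AlmostEverywhere.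
Context (d : measure_display) (X : measurableType d) (R : realType).
Variable nu : probability X R.

(** Banach's principle: if u is, up to errors whose supremum over n has
    arbitrarily small integral, a sequence that converges almost everywhere,
    then almost every u n x is a Cauchy sequence, because the infimum of the
    suprema has integral 0. *)
Lemma ae_cvg_approx (u : nat -> X -> R) :
  (forall e, 0 < e -> exists (v : nat -> X -> R) (S : X -> \bar R),
     [/\ measurable_fun setT S, forall x, (0 <= S x)%E,
         (\int[nu]_x S x <= e%:E)%E,
         {ae nu, forall x, cvgn (v ^~ x)} &
         \forall n \near \oo, forall x, (`|u n x - v n x|%:E <= S x)%E]) ->
  {ae nu, forall x, cvgn (u ^~ x)}.
Proof.
move=> H; have eps0 (k : nat) : 0 < k.+1%:R^-1 :> R by rewrite invr_gt0.
have /choice[v /choice[S vS]] := fun k => H _ (eps0 k).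
(* The pointwise infimum of the error bounds. *)
pose G x := einfs (S ^~ x) 0%N.
have GS k x : (G x <= S k x)%E by apply: ereal_inf_lbound; exists k.
have G0 x : (0 <= G x)%E.
  by apply: le_ereal_inf_tmp => _ [k _ <-]; case: (vS k) => _ + _ _ _; exact.
have mS k : measurable_fun setT (S k) by case: (vS k).
have mG : measurable_fun setT G by exact: measurable_fun_einfs.
have intG : (\int[nu]_x `|G x| = 0)%E.
  apply/eqP; rewrite eq_le; apply/andP; split; last exact: integral_ge0.
  apply/lee_addgt0Pr => e e0; rewrite add0e.
  have [k ke] : exists k : nat, k.+1%:R^-1 <= e.
    exists (Num.truncn e^-1).
    rewrite invf_ple ?posrE//; exact/ltW/truncnS_gt.
  apply: (@le_trans _ _ (\int[nu]_x S k x)%E).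
    apply: ge0_le_integral => //; first exact: measurableT_comp.
    by move=> x _; rewrite gee0_abs.
  by have [_ _ + _ _] := vS k; move/le_trans; apply; rewrite lee_fin.
have aeG : {ae nu, forall x, G x = 0%E}.
  have /(ae_eq_integral_abs nu measurableT mG) := intG.
  by apply: filterS => x /(_ I).
have aev : {ae nu, forall x, forall k, cvgn (v k ^~ x)}.
  by apply: ae_foralln => k; case: (vS k).
apply: filterS2 aeG aev => x Gx vx.
apply: cvgn_of_approx => e e0.
have e2 : 0 < e / 2 by rewrite divr_gt0.
have [k Sk] : exists k, (S k x < (e / 2)%:E)%E.
  have : (G x < (e / 2)%:E)%E by rewrite Gx lte_fin.
  by move/ereal_inf_lt => [_ [k _ <-]]; exists k.
have [_ _ _ _ uv] := vS k.
exists (limn (v k ^~ x)).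
have /cvgrPdist_lt /(_ _ e2) vl : v k ^~ x @ \oo --> limn (v k ^~ x) by exact: vx.
near=> n.
have h1 : `|limn (v k ^~ x) - v k n x| < e / 2 by near: n.
have h2 : `|u n x - v k n x| < e / 2.
  rewrite -lte_fin; apply: le_lt_trans Sk.
  have : forall x, (`|u n x - v k n x|%:E <= S k x)%E by near: n.
  exact.
rewrite (_ : _ - _ = limn (v k ^~ x) - v k n x - (u n x - v k n x)); last by ring.
by rewrite (le_lt_trans (ler_normB _ _))//; lra.
Unshelve. all: by end_near. Qed.

Lemma sum_half (n : nat) : \sum_(0 <= k < n) (2 ^+ k.+1)^-1 <= 1 :> R.
Proof.
suff -> : \sum_(0 <= k < n) (2 ^+ k.+1)^-1 = 1 - (2 ^+ n)^-1 :> R.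
  by rewrite lerBlDr lerDl invr_ge0 exprn_ge0.
elim: n => [|n IHn]; first by rewrite big_nil expr0 invr1 subrr.
rewrite big_nat_recr//= IHn exprS; field.
by rewrite expf_neq0.
Qed.

Lemma ae_cvg_summable (g : nat -> X -> R) : (forall n, bounded_mfun (g n)) ->
  (forall k, mean nu (fun x => `|g k.+1 x - g k x|) <= (2 ^+ k.+1)^-1) ->
  {ae nu, forall x, cvgn (g ^~ x)}.
Proof.
move=> bg gk.
pose D k x := `|g k.+1 x - g k x|.
have bD k : bounded_mfun (D k) by exact/bmf_norm/bmfB.
have mD k : measurable_fun setT (EFin \o D k) by exact/measurable_EFinP/(bD k).1.
have intS : (\int[nu]_x (\sum_(0 <= k <oo) (D k x)%:E) <= 1)%E.
  rewrite integral_nneseries//; last by move=> k x _; rewrite lee_fin /D.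
  apply: lime_le.
    by apply: is_cvg_nneseries => k _ _; apply: integral_ge0 => x _; rewrite lee_fin /D.
  apply: nearW => n; under eq_bigr do rewrite -EFin_mean//.
  rewrite sumEFin lee_fin; apply: le_trans (sum_half n).
  by apply: ler_sum => k _; exact: gk.
have mS : measurable_fun setT (fun x => \sum_(0 <= k <oo) (D k x)%:E)%E.
  apply: (emeasurable_fun_cvg (fun n x => \sum_(0 <= k < n) (D k x)%:E)%E).
    by move=> n; apply: emeasurable_sum.
  by move=> x _; apply: is_cvg_nneseries => k _ _; rewrite lee_fin /D.
have S0 x : (0 <= \sum_(0 <= k <oo) (D k x)%:E)%E.
  by apply: nneseries_ge0 => k _ _; rewrite lee_fin /D.
have iS : nu.-integrable setT (fun x => \sum_(0 <= k <oo) (D k x)%:E)%E.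
  apply/integrableP; split => //.
  under eq_integral do rewrite gee0_abs//.
  exact: le_lt_trans intS (ltry _).
have := integrable_ae measurableT iS; apply: filterS => x /(_ I) fx.
have : cvgn (series (telescope (g ^~ x))).
  apply: normed_cvg; apply: nondecreasing_is_cvgn.
    by apply: nondecreasing_series => k _ _; exact: normr_ge0.
  exists (fine (\sum_(0 <= k <oo) (D k x)%:E)%E) => _ [n _ <-].
  rewrite -lee_fin fineK// /series/= -sumEFin.
  by apply: (nneseries_lim_ge (u_ := fun k => (D k x)%:E)) => k _ _; rewrite lee_fin /D.
rewrite telescopeK => cg.
have -> : g ^~ x = (fun n => (g n x - g 0%N x) + g 0%N x).
  by apply/funext => n; rewrite subrK.
by apply: is_cvgD => //; exact: is_cvg_cst.
Qed.

Lemma mean_cvg0_bounded (g : nat -> X -> R) (M : R) :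
  (forall n, bounded_mfun (g n)) -> (forall n x, `|g n x| <= M) ->
  {ae nu, forall x, g ^~ x @ \oo --> (0 : R)} ->
  (fun n => mean nu (fun x => `|g n x|)) @ \oo --> (0 : R).
Proof.
move=> bg gM g0.
have mg n : measurable_fun setT (EFin \o g n) by exact/measurable_EFinP/(bg n).1.
have [||||_ + _] := @dominated_convergence _ _ _ nu setT measurableT
  (fun n x => (g n x)%:E) (cst 0%E) (cst M%:E) mg.
- exact: measurable_cst.
- apply: filterS g0 => x gx _.
  by apply/fine_cvgP; split; [exact: nearW | exact: gx].
- by apply: bmf_integrable; exact: bmf_cst.
- by apply: aeW => x n _; rewrite /= lee_fin gM.
move=> /fine_cvgP[_]; apply: cvg_trans; apply: near_eq_cvg; apply: nearW => n.
rewrite /mean /Rintegral /=; congr fine; apply: eq_integral => x _.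
by rewrite /= ?sube0 ?subr0 ?oppr0 ?addr0.
Qed.

(** Riesz-Fischer: a subsequence with summable increments converges almost
    everywhere, and boundedness turns this into convergence in mean. *)
Lemma L1_complete_bounded (f : nat -> X -> R) (M : R) :
  (forall n, bounded_mfun (f n)) -> (forall n x, `|f n x| <= M) ->
  (forall e, 0 < e -> exists N, forall n k, (N <= k)%N -> (k <= n)%N ->
     mean nu (fun x => `|f n x - f k x|) <= e) ->
  exists2 psi, bounded_mfun psi &
    (fun n => mean nu (fun x => `|f n x - psi x|)) @ \oo --> (0 : R).
Proof.
move=> bf fM fC.
have eps0 (k : nat) : 0 < (2 ^+ k.+1)^-1 :> R by rewrite invr_gt0 exprn_gt0.
have /choice[N HN] := fun k => fC _ (eps0 k).
(* Partial sums make the extraction nondecreasing and at least k. *)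
pose K k := (\sum_(l < k.+1) (N l).+1)%N.
have KN k : (N k <= K k)%N.
  by rewrite /K big_ord_recr (leq_trans (leqnSn _))// leq_addl.
have KS k : (K k <= K k.+1)%N.
  by rewrite /K [leqRHS]big_ord_recr leq_addr.
pose g k := f (K k).
have aeg : {ae nu, forall x, cvgn (g ^~ x)}.
  apply: ae_cvg_summable => k; first exact: bf.
  exact: HN.
(* The clamp keeps psi bounded where the subsequence diverges. *)
pose psi x := Num.max (- M) (Num.min M (limn_sup (g ^~ x))).
have M0 (x : X) : 0 <= M by exact: le_trans (normr_ge0 _) (fM 0%N x).
have psiM x : `|psi x| <= M.
  rewrite ler_norml /psi le_max lexx/= ge_max ge_min lexx andbT.
  by rewrite -subr_ge0 opprK addr_ge0 ?(M0 x).
have bpsi : bounded_mfun psi.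
  split; last by exists M.
  apply: measurable_maxr => //; apply: measurable_minr => //.
  apply: (measurable_fun_limn_sup (h := g)) => [x _|x _|k].
  - by exists M => _ [k _ <-]; rewrite (le_trans (ler_norm _))// fM.
  - by exists (- M) => _ [k _ <-]; have := fM (K k) x; rewrite ler_norml => /andP[].
  - exact: (bf (K k)).1.
exists psi => //.
have g0 : (fun k => mean nu (fun x => `|g k x - psi x|)) @ \oo --> (0 : R).
  apply: (mean_cvg0_bounded (M := M + M)) => [k|k x|].
  - by apply: bmfB => //; exact: bf.
  - by rewrite (le_trans (ler_normB _ _))// lerD//; exact: fM.
  apply: filterS aeg => x gx.
  have l1 : limn (g ^~ x) <= M.
    by apply: limr_le => //; apply: nearW => k; rewrite (le_trans (ler_norm _))// fM.
  have l2 : - M <= limn (g ^~ x).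
    by apply: limr_ge => //; apply: nearW => k; have := fM (K k) x;
      rewrite ler_norml => /andP[].
  have -> : psi x = limn (g ^~ x).
    by rewrite /psi cvg_limn_supE// (min_idPr l1) (max_idPr l2).
  rewrite -(subrr (limn (g ^~ x))); apply: cvgB => //; exact: cvg_cst.
apply/cvgr0Pnorm_le => e e0; have e2 : 0 < e / 2 by rewrite divr_gt0.
have [N0 hN0] := fC _ e2.
have /cvgr0Pnorm_le /(_ _ e2) [N1 _ hN1] := g0.
have kK k : (k <= K k)%N.
  elim: k => // k IHk; rewrite /K big_ord_recr -[(\sum_(i < k.+1) _)%N]/(K k) /=.
  by rewrite addnS ltnS (leq_trans IHk)// leq_addr.
pose k := (N0 + N1)%N.
exists (K k) => // n /= Kn; rewrite ger0_norm ?mean_ge0//.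
apply: (le_trans (mean_norm_triangle nu (bf n) (bf (K k)) bpsi)).
have h1 : mean nu (fun x => `|f n x - f (K k) x|) <= e / 2.
  by apply: hN0 => //; apply: leq_trans (kK k); rewrite leq_addr.
have h2 : mean nu (fun x => `|f (K k) x - psi x|) <= e / 2.
  by apply: le_trans (ler_norm _) (hN1 k _); rewrite /= leq_addl.
by rewrite (splitr e) lerD.
Qed.

End AlmostEverywhere.

(** * Maximal functions and the bounded case *)

Section MaximalFunction.
Context (d : measure_display) (X : measurableType d) (R : realType).
Context (nu : probability X R) (A : finType) (opp : A -> A).
Context (tau : A -> X -> X) (p : A -> R) (q : A -> A -> R).
Hypothesis C : reversible_chain nu opp tau p q.
Local Notation step := (step tau q).
Local Notation flip := (flip opp tau).
Local Notation expect := (expect nu p).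
Implicit Types f g h : A -> X -> R.

Definition trunc h (N : nat) j x : R := Num.min (h j x) N%:R.

Lemma bfam_trunc h N : (forall j, measurable_fun setT (h j)) ->
  (forall j x, 0 <= h j x) -> bounded_family (trunc h N).
Proof.
move=> mh h0 j; split; first exact: measurable_minr.
by exists N%:R => x; rewrite ger0_norm ?le_min ?h0 ?ler0n//= ge_min lexx orbT.
Qed.

Lemma trunc_ge0 h N : (forall j x, 0 <= h j x) -> forall j x, 0 <= trunc h N j x.
Proof. by move=> h0 j x; rewrite le_min h0 ler0n. Qed.

Lemma trunc_le h N j x : trunc h N j x <= h j x.
Proof. by rewrite ge_min lexx. Qed.

Lemma trunc_homo h M N j x : (M <= N)%N -> trunc h M j x <= trunc h N j x.
Proof.
by move=> MN; rewrite le_min ge_min lexx /= ge_min ler_nat MN orbT.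
Qed.

Lemma iter_trunc_near h m j x :
  \forall N \near \oo, iter m step (trunc h N) j x = iter m step h j x.
Proof.
elim: m j x => [|m IHm] j x /=.
  near=> N; rewrite /trunc; apply/min_idPl.
  by near: N; exact: nbhs_infty_ger.
have : \forall N \near \oo, forall i,
    iter m step (trunc h N) i (tau j x) = iter m step h i (tau j x).
  by apply: filter_forall => i; exact: IHm.
by apply: filterS => N H; apply: eq_bigr => i _; rewrite H.
Unshelve. all: by end_near. Qed.

Lemma running_max_le (g1 g2 : nat -> A -> X -> R) n m j x : (n <= m)%N ->
  (forall k, g1 k j x <= g2 k j x) ->
  running_max g1 n j x <= running_max g2 m j x.
Proof.
move=> nm g12; apply: (@le_trans _ _ (running_max g2 n j x)).
  elim: n {nm} => //= n IHn.
  by rewrite ge_max !le_max IHn g12 orbT.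
elim: m nm => [|m IHm]; first by rewrite leqn0 => /eqP ->.
by rewrite leq_eqVlt => /predU1P[->//|nm]; rewrite /= le_max IHm.
Qed.

Lemma running_max_ge (g : nat -> A -> X -> R) k n j x : (k < n)%N ->
  g k j x <= running_max g n j x.
Proof.
move=> kn; apply: le_trans (running_max_le kn (fun _ => lexx _)).
by rewrite /= le_max lexx orbT.
Qed.

Lemma running_max_ge0 (g : nat -> A -> X -> R) n j x : 0 <= running_max g n j x.
Proof. by elim: n => //= n IHn; rewrite le_max IHn. Qed.

(** For an unbounded h, the N-th approximation takes the maximum of the first N
    even iterates of the truncation of h at height N; one index for both makes
    the sequence nondecreasing, and monotone convergence applies. *)
Theorem maximal_function : exists2 c : R, 0 < c & forall h,
  (forall j, measurable_fun setT (h j)) -> (forall j x, 0 <= h j x) ->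
  exists S : A -> X -> \bar R,
  [/\ forall j, measurable_fun setT (S j),
      forall j x, (0 <= S j x)%E,
      forall k j x, ((iter k.+1.*2 step h j x)%:E <= S j x)%E &
      forall lambda B j, 0 < lambda ->
        (forall N, expect (fun j x =>
           trunc h N j x * ln (1 + lambda * trunc h N j x)) <= B) ->
        (\int[nu]_x S j x <= ((1 + 2 * lambda * B) / (c * lambda * p j))%:E)%E].
Proof.
have [c c0 Hc] := entropy_maximal_inequality C; exists c => // h mh h0.
have bt N : bounded_family (trunc h N) by exact: bfam_trunc.
have t0 N : forall j x, 0 <= trunc h N j x by exact: trunc_ge0.
pose F N := running_max (fun k => iter k.+1.*2 step (trunc h N)) N.
have bF N : bounded_family (F N).
  by apply: bfam_running_max => k; exact: (bfam_iter C).
have Fnd j x : {homo (fun N => (F N j x)%:E) : m n / (m <= n)%N >-> (m <= n)%E}.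
  move=> m n mn; rewrite lee_fin; apply: running_max_le => // k.
  by apply: (iter_step_le C) => i y; exact: trunc_homo.
have cF j x := ereal_nondecreasing_is_cvgn (Fnd j x).
have mF j N : measurable_fun setT (fun x => (F N j x)%:E).
  exact/measurable_EFinP/(bF N j).1.
have F0 N j x : 0 <= F N j x by exact: running_max_ge0.
exists (fun j x => limn (fun N => (F N j x)%:E)); split => [j|j x|k j x|l B j l0 hB].
- by apply: (emeasurable_fun_cvg _ _ (mF j)) => x _; exact: cF.
- by apply: lime_ge; [exact: cF | apply: nearW => N; rewrite lee_fin].
- apply: lime_ge; first exact: cF.
  have := iter_trunc_near h k.+1.*2 j x; apply: filterS2 (nbhs_infty_gt k).
  move=> N kN E; rewrite lee_fin -E.
  exact: (running_max_ge (fun k => iter k.+1.*2 step (trunc h N))).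
- rewrite (monotone_convergence nu measurableT (mF j)); last 2 first.
  + by move=> n x _; rewrite lee_fin.
  + by move=> x _; exact: Fnd.
  apply: lime_le.
    apply: ereal_nondecreasing_is_cvgn => m n mn; apply: ge0_le_integral => //.
    + by move=> x _; rewrite lee_fin.
    + by move=> x _; exact: Fnd.
  apply: nearW => N; rewrite -EFin_mean; last exact: bF.
  rewrite lee_fin ler_pdivlMr; last by rewrite !mulr_gt0 ?(rc_p_gt0 C).
  rewrite mulrC -mulrA; apply: (@le_trans _ _ (c * l * expect (F N))).
    rewrite (mulrA c) -[leLHS]mulrA ler_wpM2l ?mulr_ge0 ?(ltW c0) ?(ltW l0)//.
    by rewrite (mean_le_expect C).
  apply: (le_trans (Hc _ l N (bt N) (t0 N) l0)).
  by rewrite lerD2l ler_wpM2l ?hB// mulr_ge0// ltW.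
Qed.

Lemma xln_ge0 (lambda t : R) : 0 < lambda -> 0 <= t -> 0 <= t * ln (1 + lambda * t).
Proof.
by move=> l0 t0; rewrite mulr_ge0// ln_ge0// lerDl mulr_ge0// ltW.
Qed.

Lemma xln_homo (lambda s t : R) : 0 < lambda -> 0 <= s -> s <= t ->
  s * ln (1 + lambda * s) <= t * ln (1 + lambda * t).
Proof.
move=> l0 s0 st; have t0 := le_trans s0 st.
have lu (u : R) : 0 <= u -> 1 <= 1 + lambda * u.
  by move=> u0; rewrite lerDl mulr_ge0// ltW.
have pos (u : R) : 0 <= u -> 0 < 1 + lambda * u.
  by move=> /lu; apply: lt_le_trans.
apply: ler_pM => //; first by rewrite ln_ge0// lu.
by rewrite ler_ln ?posrE ?pos// lerD2l ler_pM2l.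
Qed.

Lemma xln_le_sqr (lambda t : R) : 0 < lambda -> 0 <= t ->
  t * ln (1 + lambda * t) <= lambda * t ^+ 2.
Proof.
move=> l0 t0; rewrite expr2 mulrCA ler_wpM2l//; apply: le_ln1Dx.
by apply: (@lt_le_trans _ _ 0); rewrite ?ltrN10// mulr_ge0// ltW.
Qed.

Lemma bfam_xln lambda h : 0 < lambda -> bounded_family h ->
  (forall j x, 0 <= h j x) ->
  bounded_family (fun j x => h j x * ln (1 + lambda * h j x)).
Proof.
move=> l0 bh h0 j; apply: bmfM => //; apply: bmf_ln => [|x].
  by apply: bmfD; [exact: bmf_cst | exact: bmfZ].
by rewrite lerDl mulr_ge0// ltW.
Qed.

(** Two more steps shift the sequence of even iterates, so its limit is fixed
    by two steps. *)
Lemma even_limit f : bounded_family f ->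
  exists psi : A -> X -> R, [/\ bounded_family psi,
    (fun n => expect (fun j x => `|iter n.*2 step f j x - psi j x|)) @ \oo --> (0 : R)
    & expect (fun j x => `|step (step psi) j x - psi j x|) = 0].
Proof.
move=> bf; have [M M0 fM] := bfam_bound bf.
have bu n : bounded_family (iter n step f) by exact: bfam_iter C n _ bf.
have lim_ j : exists2 psi, bounded_mfun psi &
    (fun n => mean nu (fun x => `|iter n.*2 step f j x - psi x|)) @ \oo --> (0 : R).
  apply: (L1_complete_bounded (M := M)) => [n|n x|e e0].
  - exact: bu.
  - exact: (iter_step_bound C).
  have pj := rc_p_gt0 C j.
  have e1 : 0 < p j * e ^+ 2 by rewrite mulr_gt0// exprn_gt0.
  have [N hN] := cauchy_energy C bf e1; exists N => n k Nk kn.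
  have bd : bounded_family (fun j x => iter n.*2 step f j x - iter k.*2 step f j x).
    by apply: bfamB; exact: bu.
  have := hN n k Nk kn; set g := fun j x => _ - _ => He.
  have : p j * mean nu (fun x => g j x ^+ 2) <= p j * e ^+ 2.
    apply: le_trans He; apply: (mean_le_expect C j (f := fun j x => g j x ^+ 2)).
      by move=> i; exact: bmfX (bd i).
    by move=> i x; exact: sqr_ge0.
  rewrite ler_pM2l// => He2.
  have := le_trans (mean_norm_sqr nu (bd j)) He2.
  by rewrite ler_pXn2r ?nnegrE ?mean_ge0 ?(ltW e0).
have {lim_}/choice[psi psiP] : forall j, exists psi, bounded_mfun psi /\
    (fun n => mean nu (fun x => `|iter n.*2 step f j x - psi x|)) @ \oo --> (0 : R).
  by move=> j; have [psi] := lim_ j; exists psi.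
have bpsi : bounded_family psi by move=> j; case: (psiP j).
have cpsi : (fun n => expect (fun j x => `|iter n.*2 step f j x - psi j x|)) @ \oo
    --> (0 : R).
  have -> : (0 : R) = \sum_(j : A) p j * 0 by rewrite -mulr_suml mulr0.
  apply: cvg_sum_seq => j; apply: cvgM; first exact: cvg_cst.
  by case: (psiP j).
exists psi; split => //.
have s0 : (fun n => expect (fun j x => `|iter n.*2 step f j x - psi j x|) +
    expect (fun j x => `|iter n.+1.*2 step f j x - psi j x|)) @ \oo --> (0 : R).
  have := cpsi; rewrite -cvg_shiftS => cpsi1.
  by rewrite -[X in _ --> X](addr0 (0 : R)); apply: cvgD.
have bss : bounded_family (step (step psi)) by exact: (bfam_iter C 2).
have bd n : bounded_family (fun j x => iter n.*2 step f j x - psi j x).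
  by apply: bfamB => //; exact: bu.
apply/eqP; rewrite eq_le (expect_ge0 C) ?andbT//.
apply/ler_addgt0Pr => e e0; rewrite add0r.
have /cvgr0Pnorm_le /(_ _ e0) [N _ /(_ N (leqnn N))] := s0.
apply: le_trans; apply: le_trans (ler_norm _).
have := expect_norm_iter C 2 (bd N); rewrite iter_stepB => H.
apply: le_trans (lerD H (lexx _)).
rewrite -expectD; last 2 first.
- by apply: bfam_norm; apply: bfamB; exact: (bfam_iter C).
- exact: bfam_norm (bd N.+1).
apply: (expect_le C) => [||j x].
- exact/bfam_norm/bfamB.
- apply: bfamD; last exact: bfam_norm (bd N.+1).
  by apply: bfam_norm; apply: bfamB; exact: (bfam_iter C).
rewrite -[in leRHS]iterD -[iter 2 step psi]/(step (step psi)) add2n -doubleS.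
rewrite [leRHS]addrC (_ : _ - psi j x = (iter N.+1.*2 step f j x - psi j x) -
  (iter N.+1.*2 step f j x - step (step psi) j x)) ?ler_normB//; ring.
Qed.

Lemma mean0_ae (g : X -> R) : bounded_mfun g -> mean nu (fun x => `|g x|) = 0 ->
  {ae nu, forall x, g x = 0}.
Proof.
move=> bg g0.
have mg : measurable_fun setT (EFin \o g) by exact/measurable_EFinP/bg.1.
have /(ae_eq_integral_abs nu measurableT mg) : (\int[nu]_x `|(EFin \o g) x| = 0)%E.
  by rewrite -[RHS](congr1 EFin g0) EFin_mean//; exact: bmf_norm.
by apply: filterS => x /(_ I) /eqP; rewrite /= eqe => /eqP.
Qed.

(** With g = |Q^2K f - psi| for large K, every later iterate differs from psi by
    at most the maximal function of g, almost everywhere.  As g is bounded,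
    g log (1 + lambda g) is at most a constant times lambda g: a large lambda
    followed by a large K makes the integral of the maximal function small. *)
Lemma bounded_ae_cvg f : bounded_family f ->
  forall j, {ae nu, forall x, cvgn (fun n => iter n.*2 step f j x)}.
Proof.
move=> bf j; have [psi [bpsi cpsi fix_psi]] := even_limit bf.
have [M M0 fM] := bfam_bound bf; have [M' M'0 psiM] := bfam_bound bpsi.
have bu n : bounded_family (iter n step f) by exact: bfam_iter C n _ bf.
have bd k : bounded_family (fun j x => iter k.*2 step f j x - psi j x).
  by apply: bfamB => //; exact: bu.
have fix_iter m : expect (fun j x => `|iter m.*2 step psi j x - psi j x|) = 0.
  elim: m => [|m IHm].
    under eq_fun do under eq_fun do rewrite subrr normr0.
    exact: (expect_cst C).
  have bss : bounded_family (step (step psi)) by exact: (bfam_iter C 2).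
  have b1 : bounded_family (fun j x => step (step psi) j x - psi j x) by exact: bfamB.
  have b2 : bounded_family (fun j x => iter m.*2 step psi j x - psi j x).
    by apply: bfamB => //; exact: (bfam_iter C).
  apply/eqP; rewrite eq_le (expect_ge0 C) ?andbT//.
  rewrite -[leRHS](addr0 0) -{1}fix_psi -IHm.
  apply: le_trans (lerD (expect_norm_iter C m.*2 b1) (lexx _)).
  rewrite iter_stepB -expectD; last 2 first.
  - by apply: bfam_norm; apply: bfamB; exact: (bfam_iter C).
  - exact: bfam_norm.
  apply: (expect_le C) => [||i x].
  - by apply/bfam_norm/bfamB => //; exact: (bfam_iter C).
  - apply: bfamD; last exact: bfam_norm.
    by apply: bfam_norm; apply: bfamB; exact: (bfam_iter C).
  have -> : iter m.+1.*2 step psi = iter m.*2 step (step (step psi)).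
    by rewrite doubleS !iterSr.
  rewrite (_ : _ - psi i x = (iter m.*2 step (step (step psi)) i x -
    iter m.*2 step psi i x) + (iter m.*2 step psi i x - psi i x)) ?ler_normD//.
  by rewrite addrA subrK.
have aepsi : {ae nu, forall x, forall m, iter m.*2 step psi j x = psi j x}.
  apply: ae_foralln => m.
  have bm : bounded_family (fun j x => iter m.*2 step psi j x - psi j x).
    by apply: bfamB => //; exact: (bfam_iter C).
  have m0 : mean nu (fun x => `|iter m.*2 step psi j x - psi j x|) = 0.
    apply/eqP; rewrite eq_le mean_ge0 ?andbT// -(ler_pM2l (rc_p_gt0 C j)) mulr0.
    rewrite -(fix_iter m).
    apply: (mean_le_expect C j
      (f := fun j x => `|iter m.*2 step psi j x - psi j x|)) => //.
    exact: bfam_norm.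
  by apply: filterS (mean0_ae (bm j) m0) => x /eqP; rewrite subr_eq0 => /eqP.
have [c c0 Hc] := maximal_function.
apply: ae_cvg_approx => e e0.
have pj := rc_p_gt0 C j.
pose l := 2 / (e * (c * p j)).
have cp : 0 < c * p j by rewrite mulr_gt0.
have l0 : 0 < l by rewrite divr_gt0// mulr_gt0.
have lE : e * (c * l * p j) = 2.
  by rewrite /l; field; rewrite !gt_eqF.
clearbody l.
have [MM MM0 leMM] : exists2 MM, 0 < MM & M + M' <= MM.
  by exists (M + M' + 1); rewrite ?lerDl// ltr_wpDl// addr_ge0.
have ll0 : 0 < 2 * l * (l * MM) by rewrite !mulr_gt0.
pose eta := (2 * l * (l * MM))^-1.
have eta0 : 0 < eta by rewrite invr_gt0.
have /cvgr0Pnorm_le /(_ _ eta0) [K _ /(_ K (leqnn K)) hK] := cpsi.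
pose g := fun j x => `|iter K.*2 step f j x - psi j x|.
have bg : bounded_family g by exact: bfam_norm (bd K).
have g0 i x : 0 <= g i x by exact: normr_ge0.
have gM i x : g i x <= MM.
  apply: le_trans leMM; apply: (le_trans (ler_normB _ _)); apply: lerD => //.
  exact: (iter_step_bound C).
have mg i : measurable_fun setT (g i) by exact: (bg i).1.
have [S [mS S0 Sge HS]] := Hc g mg g0.
exists (fun n x => iter (n - K).*2 step psi j x), (S j); split.
- exact: mS.
- exact: S0.
- apply: (le_trans (HS l (l * MM * expect g) j l0 _)).
    move=> N; rewrite -expectZ//; apply: (expect_le C) => [||i x].
    + by apply: bfam_xln => //; [exact: bfam_trunc | exact: trunc_ge0].
    + exact: bfamZ.
    apply: (le_trans (xln_le_sqr l0 (trunc_ge0 N g0 i x))).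
    rewrite -[leRHS]mulrA ler_pM2l// expr2; apply: ler_pM; try exact: trunc_ge0.
      exact: le_trans (trunc_le _ _ _ _) (gM i x).
    exact: trunc_le.
  have Eg : expect g <= eta by apply: le_trans hK; exact: ler_norm.
  rewrite lee_fin ler_pdivrMr ?lE; last by rewrite !mulr_gt0.
  have : 2 * l * (l * MM * expect g) <= 1.
    rewrite mulrA; apply: (@le_trans _ _ (2 * l * (l * MM) * eta)).
      by rewrite ler_wpM2l// ltW.
    by rewrite /eta mulfV// gt_eqF.
  by lra.
- apply: filterS aepsi => x Hx.
  under eq_fun do rewrite Hx.
  exact: is_cvg_cst.
- near=> n => x.
  have Kn : (K < n)%N by near: n; exact: nbhs_infty_gt.
  have [m nE] : exists m, n = (m.+1 + K)%N.
    by exists (n - K).-1; rewrite prednK ?subn_gt0// subnK// ltnW.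
  have -> : (n - K)%N = m.+1 by rewrite nE addnK.
  have -> : iter n.*2 step f = iter m.+1.*2 step (iter K.*2 step f).
    by rewrite nE doubleD iterD.
  apply: le_trans (Sge m j x); rewrite lee_fin.
  have := norm_iter C m.+1.*2 (fun j x => iter K.*2 step f j x - psi j x) j x.
  by rewrite iter_stepB.
Unshelve. all: by end_near. Qed.

End MaximalFunction.

(** * Truncation errors in L log L *)

Section LlogLTails.
Context (d : measure_display) (X : measurableType d) (R : realType).
Variable nu : probability X R.
Implicit Types phi : X -> R.

Definition cutoff phi (M : nat) x : R := phi x * (`|phi x| <= M%:R)%R%:R.
Definition tail phi (M : nat) x : R := `|phi x - cutoff phi M x|.

Lemma tailE phi M x : tail phi M x = if `|phi x| <= M%:R then 0 else `|phi x|.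
Proof.
by rewrite /tail /cutoff; case: ifP => _; rewrite ?mulr1 ?mulr0 ?subrr ?subr0 ?normr0.
Qed.

Lemma tail_le phi M x : tail phi M x <= `|phi x|.
Proof. by rewrite tailE; case: ifP. Qed.

Lemma measurable_cutoff phi M : measurable_fun setT phi ->
  measurable_fun setT (cutoff phi M).
Proof.
move=> mphi; apply: measurable_funM => //.
apply: (measurableT_comp (f := fun c : bool => c%:R : R)) => //.
by apply: measurable_fun_ler => //; exact: measurableT_comp.
Qed.

Lemma bmf_cutoff phi M : measurable_fun setT phi -> bounded_mfun (cutoff phi M).
Proof.
move=> mphi; split; first exact: measurable_cutoff.
exists M%:R => x; rewrite /cutoff; case: (leP `|phi x| M%:R) => h.
  by rewrite mulr1.
by rewrite mulr0 normr0.
Qed.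

Lemma measurable_tail phi M : measurable_fun setT phi ->
  measurable_fun setT (tail phi M).
Proof.
move=> mphi; apply: measurableT_comp => //.
by apply: measurable_funB => //; exact: measurable_cutoff.
Qed.

Lemma xln_le_log_plus (lambda t : R) : 0 < lambda -> 0 <= t ->
  t * ln (1 + lambda * t) <= t * (ln (1 + lambda) + log_plus t).
Proof.
move=> l0 t0; apply: ler_wpM2l => //; rewrite /log_plus.
have [t1|t1] := leP t 1.
  rewrite -[leLHS]addr0 lerD ?le_max ?lexx//.
  have lt0 : 0 <= lambda * t by rewrite mulr_ge0// ltW.
  rewrite ler_ln ?posrE; [|lra|lra].
  by rewrite lerD2l -[leRHS]mulr1 ler_pM2l.
apply: (@le_trans _ _ (ln (1 + lambda) + ln t)); last first.
  by rewrite lerD2l le_max lexx orbT.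
have lt0 : 0 < lambda * t by rewrite mulr_gt0//; lra.
rewrite -lnM ?posrE; [|lra|lra].
rewrite ler_ln ?posrE; [|lra|rewrite mulr_gt0; lra].
by rewrite mulrDl mul1r lerD2r ltW.
Qed.

Lemma measurable_xln (lambda : R) (h : X -> R) : measurable_fun setT h ->
  measurable_fun setT (fun x => h x * ln (1 + lambda * h x)).
Proof.
move=> mh; apply: measurable_funM => //.
apply: measurableT_comp; first exact: measurable_ln.
by apply: measurable_funD => //; exact: measurable_funM.
Qed.

Lemma LlogL_integrable_xln phi (lambda : R) : 0 < lambda -> LlogL nu phi ->
  nu.-integrable setT
    (fun x => (`|phi x| * (ln (1 + lambda) + log_plus `|phi x|))%:E).
Proof.
move=> l0 [iphi Lphi].
have mphi : measurable_fun setT phi by apply/measurable_EFinP; exact: (measurable_int nu).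
have mn : measurable_fun setT (fun x => `|phi x|) by exact: measurableT_comp.
have inorm : nu.-integrable setT (EFin \o (fun x => `|phi x|)).
  exact: integrable_norm.
have il : nu.-integrable setT (fun x => (`|phi x| * log_plus `|phi x|)%:E).
  apply/integrableP; split.
    apply/measurable_EFinP/measurable_funM => //.
    apply: measurable_maxr => //.
    by apply: measurableT_comp => //; exact: measurable_ln.
  under eq_integral => x _.
    rewrite gee0_abs; last by rewrite lee_fin mulr_ge0// le_max lexx.
    over.
  exact: Lphi.
rewrite (_ : (fun x => _) = (fun x => (ln (1 + lambda))%:E * (`|phi x|)%:E +
    (`|phi x| * log_plus `|phi x|)%:E)%E); last first.
  by apply/funext => x; rewrite mulrDr EFinD mulrC.
apply: integrableD => //; exact: integrableZl.
Qed.

Lemma mean_trunc_xln_le (lambda B : R) (h : X -> R) N : 0 < lambda ->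
  measurable_fun setT h -> (forall x, 0 <= h x) ->
  (\int[nu]_x (h x * ln (1 + lambda * h x))%:E <= B%:E)%E ->
  mean nu (fun x => Num.min (h x) N%:R * ln (1 + lambda * Num.min (h x) N%:R)) <= B.
Proof.
move=> l0 mh h0 hB.
have m0 x : 0 <= Num.min (h x) N%:R by rewrite le_min h0 ler0n.
have mm : measurable_fun setT (fun x => Num.min (h x) N%:R).
  exact: measurable_minr.
have bm : bounded_mfun (fun x => Num.min (h x) N%:R).
  by split => //; exists N%:R => x; rewrite ger0_norm// ge_min lexx orbT.
rewrite -lee_fin EFin_mean; last first.
  apply: bmfM => //; apply: bmf_ln => [|x].
    by apply: bmfD; [exact: bmf_cst | exact: bmfZ].
  by rewrite lerDl mulr_ge0// ltW.
apply: le_trans hB; apply: ge0_le_integral => //.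
- by move=> x _; rewrite lee_fin xln_ge0.
- by apply/measurable_EFinP; exact: measurable_xln.
- by apply/measurable_EFinP; exact: measurable_xln.
- by move=> x _; rewrite lee_fin xln_homo// ge_min lexx.
Qed.

(** Dominated convergence: the truncation error vanishes at each point from
    some height on, and |phi| log (1 + lambda |phi|) is integrable for phi in
    L log L. *)
Lemma LlogL_tail_small phi (lambda e : R) : LlogL nu phi -> 0 < lambda -> 0 < e ->
  exists M, forall N, mean nu (fun x => Num.min (tail phi M x) N%:R *
    ln (1 + lambda * Num.min (tail phi M x) N%:R)) <= e.
Proof.
move=> Lphi l0 e0; have iD := LlogL_integrable_xln l0 Lphi.
have mphi : measurable_fun setT phi.
  by apply/measurable_EFinP; apply: (measurable_int nu); case: Lphi.
pose G M x := (tail phi M x * ln (1 + lambda * tail phi M x))%:E.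
have mG M : measurable_fun setT (G M).
  by apply/measurable_EFinP/measurable_xln; exact: measurable_tail.
have G0 M x : (0 <= G M x)%E by rewrite lee_fin xln_ge0// /tail.
have [|||_ + _] := @dominated_convergence _ _ _ nu setT measurableT
  G (cst 0%E) _ mG _ _ iD.
- exact: measurable_cst.
- apply: aeW => x _; apply: cvg_near_cst.
  have := nbhs_infty_ger `|phi x|; apply: filterS => M hM.
  by rewrite /G tailE hM mul0r.
- apply: aeW => x M _; rewrite gee0_abs// lee_fin.
  apply: (le_trans (xln_homo l0 _ (tail_le phi M x))); first exact: normr_ge0.
  exact: xln_le_log_plus.
move=> /fine_cvgP[fin /cvgr0Pnorm_le /(_ _ e0) small].
case: (filterI fin small) => M _ /(_ M (leqnn M)) [/= finM smallM].
exists M => N; apply: mean_trunc_xln_le => //.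
- exact: measurable_tail.
- by move=> x; exact: normr_ge0.
have EG : (\int[nu]_x `|G M x - cst 0%E x| = \int[nu]_x G M x)%E.
  by apply: eq_integral => x _; rewrite -[cst 0%E x]/(0%E : \bar R) sube0 gee0_abs.
rewrite EG in finM; rewrite /= EG in smallM.
have : (\int[nu]_x G M x <= e%:E)%E.
  by rewrite -(fineK finM) lee_fin; exact: le_trans (ler_norm _) smallM.
exact.
Qed.

Lemma LlogL_norm_bound phi : LlogL nu phi ->
  exists B, forall N, mean nu (fun x => Num.min `|phi x| N%:R *
    ln (1 + 1 * Num.min `|phi x| N%:R)) <= B.
Proof.
move=> Lphi; have iD := LlogL_integrable_xln ltr01 Lphi.
have mphi : measurable_fun setT phi.
  by apply/measurable_EFinP; apply: (measurable_int nu); case: Lphi.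
have mn : measurable_fun setT (fun x => `|phi x|) by exact: measurableT_comp.
exists (fine (\int[nu]_x (`|phi x| * (ln (1 + 1) + log_plus `|phi x|))%:E)%E) => N.
apply: mean_trunc_xln_le => //.
rewrite fineK; last exact: (integrable_fin_num measurableT iD).
apply: ge0_le_integral => //.
- by move=> x _; rewrite lee_fin xln_ge0.
- by apply/measurable_EFinP; exact: measurable_xln.
- exact: measurable_int iD.
- by move=> x _; rewrite lee_fin xln_le_log_plus.
Qed.

End LlogLTails.

(** * Averages over the letters *)

Section SphereAverages.
Context (d : measure_display) (X : measurableType d) (R : realType).
Context (nu : probability X R) (A : finType) (opp : A -> A).
Context (tau : A -> X -> X) (p : A -> R) (q : A -> A -> R).
Hypothesis C : reversible_chain nu opp tau p q.
Local Notation step := (step tau q).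
Implicit Types phi psi h : X -> R.

Definition sphere (n : nat) phi x : R :=
  \sum_j p j * iter n step (fun _ => phi) j x.

Lemma sphereB n phi psi x :
  sphere n (fun x => phi x - psi x) x = sphere n phi x - sphere n psi x.
Proof.
rewrite /sphere -sumrB; apply: eq_bigr => j _.
by rewrite (iter_stepB _ _ n (fun _ => phi) (fun _ => psi)) mulrBr.
Qed.

Lemma norm_sphere n phi x : `|sphere n phi x| <= sphere n (fun x => `|phi x|) x.
Proof.
apply: (le_trans (ler_norm_sum _ _ _)); apply: ler_sum => j _.
by rewrite normrM gtr0_norm ?(rc_p_gt0 C)// ler_pM2l ?(rc_p_gt0 C)// (norm_iter C).
Qed.

Lemma measurable_iter n (f : A -> X -> R) : (forall j, measurable_fun setT (f j)) ->
  forall j, measurable_fun setT (iter n step f j).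
Proof.
move=> mf; elim: n => //= n IHn j.
apply: measurable_sum => i; apply: measurable_funM => //.
by apply: measurableT_comp => //; exact: rc_measurable C j.
Qed.

Lemma measurable_sphere n phi : measurable_fun setT phi ->
  measurable_fun setT (sphere n phi).
Proof.
by move=> mphi; apply: measurable_sum => j; apply: measurable_funM => //;
  exact: measurable_iter.
Qed.

Lemma bmf_sphere n phi : bounded_mfun phi -> bounded_mfun (sphere n phi).
Proof.
move=> bphi; apply: bmf_sum => j; apply: bmfZ.
by apply: (bfam_iter C n (f := fun _ => phi)) => i.
Qed.

Lemma maximal_sphere : exists2 c : R, 0 < c & forall h,
  measurable_fun setT h -> (forall x, 0 <= h x) ->
  exists S : X -> \bar R,
  [/\ measurable_fun setT S, forall x, (0 <= S x)%E,
      forall k x, ((sphere k.+1.*2 h x)%:E <= S x)%E &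
      forall lambda B, 0 < lambda ->
        (forall N, mean nu (fun x => Num.min (h x) N%:R *
           ln (1 + lambda * Num.min (h x) N%:R)) <= B) ->
        (\int[nu]_x S x <= ((1 + 2 * lambda * B) / (c * lambda))%:E)%E].
Proof.
have [c c0 Hc] := maximal_function C.
have A0 : 0 < #|A|%:R :> R by rewrite ltr0n (leq_trans _ (rc_card C)).
exists (c / #|A|%:R) => [|h mh h0]; first by rewrite divr_gt0.
have [S [mS S0 Sge HS]] := Hc (fun _ => h) (fun _ => mh) (fun _ => h0).
have pj := rc_p_gt0 C.
have mpS j : measurable_fun setT (fun x => (p j)%:E * S j x)%E.
  by apply: emeasurable_funM => //; exact: measurable_cst.
have pS0 j x : (0 <= (p j)%:E * S j x)%E.
  by rewrite mule_ge0// lee_fin ltW.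
exists (fun x => \sum_j (p j)%:E * S j x)%E; split => [|x|k x|l B l0 hB].
- by apply: emeasurable_sum.
- by apply: sume_ge0 => j _.
- rewrite /sphere -sumEFin; apply: lee_sum => j _; rewrite EFinM.
  by rewrite lee_wpmul2l ?lee_fin ?(ltW (pj j)).
rewrite ge0_integral_sum//.
have -> : (1 + 2 * l * B) / (c / #|A|%:R * l) =
    \sum_(j : A) (1 + 2 * l * B) / (c * l).
  rewrite sumr_const -mulr_natr.
  by field; rewrite !gt_eqF.
rewrite -sumEFin; apply: lee_sum => j _.
rewrite ge0_integralZl_EFin//; last exact: ltW.
apply: (@le_trans _ _ ((p j)%:E * ((1 + 2 * l * B) / (c * l * p j))%:E)%E).
  rewrite lee_wpmul2l ?lee_fin ?(ltW (pj j))//; apply: HS => // N.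
  apply: le_trans (hB N).
  rewrite -[leRHS]mul1r -[X in _ <= X * _](rc_p_sum C) mulr_suml.
  exact: lexx.
rewrite -EFinM lee_fin le_eqVlt; apply/orP; left; apply/eqP.
by field; rewrite !gt_eqF.
Qed.

Lemma LlogL_measurable phi : LlogL nu phi -> measurable_fun setT phi.
Proof. by move=> [iphi _]; apply/measurable_EFinP; exact: (measurable_int nu). Qed.

(** The maximal function of the truncation error: first lambda is chosen of
    order 1 / e, then the height M. *)
Lemma sphere_approx phi e : LlogL nu phi -> 0 < e ->
  exists M (S : X -> \bar R), [/\ measurable_fun setT S, forall x, (0 <= S x)%E,
    (\int[nu]_x S x <= e%:E)%E &
    forall n x, (`|sphere n.+1.*2 phi x - sphere n.+1.*2 (cutoff phi M) x|%:E <= S x)%E].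
Proof.
move=> Lphi e0; have mphi := LlogL_measurable Lphi.
have [c c0 Hc] := maximal_sphere.
(* With this lambda and with entropy at most 1 / (2 lambda), the maximal
   function has integral at most 2 / (c lambda) = e. *)
have [l l0 lE] : exists2 l, 0 < l & e * (c * l) = 2.
  exists (2 / (e * c)); first by rewrite divr_gt0// mulr_gt0.
  by field; rewrite !gt_eqF.
have l1 : 0 < (2 * l)^-1 by rewrite invr_gt0 mulr_gt0.
have [M HM] := LlogL_tail_small Lphi l0 l1.
have [S [mS S0 Sge HS]] := Hc (tail phi M) (measurable_tail M mphi)
  (fun x => normr_ge0 _).
exists M, S; split => // [|n x].
  apply: le_trans (HS _ _ l0 HM) _; rewrite lee_fin.
  rewrite ler_pdivrMr ?lE ?mulr_gt0// mulfV ?gt_eqF ?mulr_gt0//.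
apply: le_trans (Sge n x); rewrite lee_fin -sphereB.
exact: norm_sphere.
Qed.

Lemma sphere_dominated phi : LlogL nu phi ->
  exists S : X -> \bar R, nu.-integrable setT S /\
    forall n x, (`|sphere n.+1.*2 phi x|%:E <= S x)%E.
Proof.
move=> Lphi; have mphi := LlogL_measurable Lphi.
have [c c0 Hc] := maximal_sphere.
have mn : measurable_fun setT (fun x => `|phi x|) by exact: measurableT_comp.
have [S [mS S0 Sge HS]] := Hc _ mn (fun x => normr_ge0 _).
have [B HB] := LlogL_norm_bound Lphi.
exists S; split => [|n x].
  apply/integrableP; split => //.
  under eq_integral do rewrite gee0_abs//.
  by apply: le_lt_trans (HS _ _ ltr01 HB) (ltry _).
by apply: le_trans (Sge n x); rewrite lee_fin norm_sphere.
Qed.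

Lemma sphere_cutoff_cvg phi M : measurable_fun setT phi ->
  {ae nu, forall x, cvgn (fun n => sphere n.*2 (cutoff phi M) x)}.
Proof.
move=> mphi; have bcut : bounded_family (fun _ : A => cutoff phi M).
  by move=> _; exact: bmf_cutoff.
have := bounded_ae_cvg C bcut => H.
have {}H : {ae nu, forall x j,
    cvgn (fun n => iter n.*2 step (fun _ => cutoff phi M) j x)}.
  exact: filter_forall.
apply: filterS H => x Hx.
apply: (cvgP (\sum_j p j * limn (fun n => iter n.*2 step (fun _ => cutoff phi M) j x))).
by apply: cvg_sum_seq => j; apply: cvgM; [exact: cvg_cst | exact: Hx].
Qed.

Lemma sphere_ae_cvg phi : LlogL nu phi ->
  {ae nu, forall x, cvgn (fun n => sphere n.*2 phi x)}.
Proof.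
move=> Lphi; have mphi := LlogL_measurable Lphi.
apply: (ae_cvg_approx (u := fun n => sphere n.*2 phi)) => e e0.
have [M [S [mS S0 Se SM]]] := sphere_approx Lphi e0.
exists (fun n => sphere n.*2 (cutoff phi M)), S; split => //.
  exact: sphere_cutoff_cvg.
by exists 1%N => // -[//|n] _ x; exact: SM.
Qed.

Lemma sphere_cutoff_regular phi M a b : measurable_fun setT phi ->
  (fun n => mean nu (fun x => `|sphere n (cutoff phi M) (tau b (tau a x)) -
     sphere n (cutoff phi M) x|)) @ \oo --> (0 : R).
Proof.
move=> mphi; have bcut : bounded_family (fun _ : A => cutoff phi M).
  by move=> _; exact: bmf_cutoff.
pose u n := iter n step (fun _ => cutoff phi M).
have bu n : bounded_family (u n) by exact: (bfam_iter C).
have but n j : bounded_mfun (fun x => u n j (tau b (tau a x)) - u n j x).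
  apply: bmfB; last exact: bu.
  apply: (bmf_comp (f := fun x => u n j (tau b x))); first exact: rc_measurable C a.
  by apply: (bmf_comp (f := u n j)); [exact: rc_measurable C b | exact: bu].
have s0 : (fun n => \sum_j p j * mean nu (fun x =>
    `|u n j (tau b (tau a x)) - u n j x|)) @ \oo --> (0 : R).
  have E0 : \sum_(j : A) p j * 0 = 0 :> R by rewrite -mulr_suml mulr0.
  rewrite -[X in _ --> X]E0; apply: (cvg_sum_seq (F := fun j n => p j * mean nu (fun x =>
    `|u n j (tau b (tau a x)) - u n j x|))) => j.
  apply: cvgM; first exact: cvg_cst.
  exact: (regular2 C bcut).
apply: (cvg0_le _ s0) => n; rewrite mean_ge0//=.
have bn j : bounded_mfun (fun x => p j * `|u n j (tau b (tau a x)) - u n j x|).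
  exact/bmfZ/bmf_norm.
apply: (@le_trans _ _ (mean nu (fun x =>
    \sum_j p j * `|u n j (tau b (tau a x)) - u n j x|))).
  apply: mean_le => [||x].
  - rewrite (_ : (fun x => _) = (fun x => `|\sum_j p j *
      (u n j (tau b (tau a x)) - u n j x)|)).
      by apply: bmf_norm; apply: bmf_sum => j; exact: bmfZ.
    apply/funext => x; rewrite /sphere -sumrB; congr (`|_|).
    by apply: eq_bigr => j _; rewrite mulrBr.
  - exact: bmf_sum.
  rewrite /sphere -sumrB; apply: (le_trans (ler_norm_sum _ _ _)).
  by apply: ler_sum => j _; rewrite -mulrBr normrM gtr0_norm ?(rc_p_gt0 C).
rewrite mean_sum//; apply: ler_sum => j _.
by rewrite meanZ//; exact: bmf_norm.
Qed.

Lemma ge0_integral_preserving (sigma : X -> X) (F : X -> \bar R) :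
  measurable_fun setT sigma ->
  (forall B, measurable B -> nu (sigma @^-1` B) = nu B) ->
  measurable_fun setT F -> (forall x, (0 <= F x)%E) ->
  (\int[nu]_x F (sigma x) = \int[nu]_x F x)%E.
Proof.
move=> ms nus mF F0.
transitivity (\int[pushforward nu sigma]_y F y)%E; last first.
  by apply: eq_measure_integral => B mB _; exact: nus.
by rewrite (ge0_integral_pushforward ms).
Qed.

(** The limit is represented by the upper limit, which is measurable even
    where the averages diverge.  For the invariance, psi is replaced by a late average
    of phi, then by the average of the same order of a truncation of phi, for
    which two letters act almost as the identity. *)
Theorem sphere_limit phi : LlogL nu phi -> exists psi,
  [/\ nu.-integrable setT (EFin \o psi),
      forall a b, {ae nu, forall x, psi (tau b (tau a x)) = psi x},
      {ae nu, forall x, (fun n => sphere n.*2 phi x) @ \oo --> psi x} &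
      (fun n => \int[nu]_x `|sphere n.*2 phi x - psi x|%:E)%E @ \oo --> 0%E].
Proof.
move=> Lphi; have mphi := LlogL_measurable Lphi.
pose psi x := fine (limn_esup (fun n => (sphere n.*2 phi x)%:E)).
have msp n : measurable_fun setT (EFin \o sphere n phi).
  exact/measurable_EFinP/measurable_sphere.
have mpsi : measurable_fun setT psi.
  apply: (measurableT_comp (f := fine)) => //.
  apply: (measurable_fun_limn_esup (f := fun n x => (sphere n.*2 phi x)%:E)).
  by move=> n; exact: msp.
have aecv : {ae nu, forall x, (fun n => sphere n.*2 phi x) @ \oo --> psi x}.
  apply: filterS (sphere_ae_cvg Lphi) => x cx.
  have cE : (fun n => (sphere n.*2 phi x)%:E) @ \oo -->
      (limn (fun n => sphere n.*2 phi x))%:E.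
    by apply/fine_cvgP; split; [exact: nearW | exact: cx].
  have -> : psi x = limn (fun n => sphere n.*2 phi x); last exact: cx.
  by rewrite /psi (cvg_limn_einf_sup cE).2.
have [S [iS domS]] := sphere_dominated Lphi.
have [|||ipsi L1 _] := @dominated_convergence _ _ _ nu setT measurableT
  (fun n x => (sphere n.+1.*2 phi x)%:E) (EFin \o psi) S (fun n => msp _) _ _ iS.
- exact/measurable_EFinP.
- apply: filterS aecv => x cx _; apply/fine_cvgP; split; first exact: nearW.
  by have := cx; rewrite -cvg_shiftS.
- by apply: aeW => x n _; exact: domS.
have L1' : (fun n => \int[nu]_x `|sphere n.*2 phi x - psi x|%:E)%E @ \oo --> 0%E.
  by rewrite -cvg_shiftS; exact: L1.
exists psi; split => // a b.
pose sigma x := tau b (tau a x).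
have msig : measurable_fun setT sigma.
  apply: (measurableT_comp (f := tau b)); first exact: rc_measurable C b.
  exact: rc_measurable C a.
have nusig B : measurable B -> nu (sigma @^-1` B) = nu B.
  move=> mB; rewrite -[RHS](rc_preserving C b mB).
  rewrite -[RHS](rc_preserving C a)//.
  by rewrite -[X in measurable X]setTI; apply: (rc_measurable C b).
have mg : measurable_fun setT (fun x => (psi (sigma x) - psi x)%:E).
  by apply/measurable_EFinP/measurable_funB => //; exact: measurableT_comp.
suff : (\int[nu]_x `|(psi (sigma x) - psi x)%:E| = 0)%E.
  move/(ae_eq_integral_abs nu measurableT mg).
  by apply: filterS => x /(_ I) /eqP; rewrite eqe subr_eq0 => /eqP.
apply/eqP; rewrite eq_le; apply/andP; split; last exact: integral_ge0.
apply/lee_addgt0Pr => e e0; rewrite add0e.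
have e5 : 0 < e / 5 by rewrite divr_gt0.
have [M [S' [mS' S'0 S'e SM]]] := sphere_approx Lphi e5.
have /cvgr0Pnorm_le /(_ _ e5) hW := sphere_cutoff_regular M a b mphi.
have hL : \forall n \near \oo,
    (\int[nu]_x `|sphere n.*2 phi x - psi x|%:E <= (e / 5)%:E)%E.
  move/fine_cvgP: L1' => [fin /cvgr0Pnorm_le /(_ _ e5) sm].
  apply: filterS2 fin sm => n fin sm.
  by rewrite -(fineK fin) lee_fin; apply: le_trans sm; exact: ler_norm.
case: hW => N1 _ hN1; case: hL => N2 _ hN2.
(* A positive order, as the truncation bound covers orders from 2 on. *)
pose n := (N1 + N2).+1.
have hW : mean nu (fun x => `|sphere n.*2 (cutoff phi M) (sigma x) -
    sphere n.*2 (cutoff phi M) x|) <= e / 5.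
  apply: le_trans (ler_norm _) (hN1 n.*2 _) => /=.
  by rewrite (leq_trans (leq_addr N2 N1))// -addnn (leq_trans (leqnSn _))// leq_addr.
have hL : (\int[nu]_x `|sphere n.*2 phi x - psi x|%:E <= (e / 5)%:E)%E.
  by apply: hN2; rewrite /= (leq_trans (leq_addl N1 N2)).
pose s := sphere n.*2 phi; pose sM := sphere n.*2 (cutoff phi M).
have ms : measurable_fun setT s by exact: measurable_sphere.
have bsM : bounded_mfun sM by apply: bmf_sphere; exact: bmf_cutoff.
(* K bounds the distance from psi to the average of the truncation. *)
pose K x := (`|s x - psi x|%:E + S' x)%E.
have mG : measurable_fun setT (fun x => `|s x - psi x|%:E).
  by apply/measurable_EFinP/measurableT_comp => //; exact: measurable_funB.
have mK : measurable_fun setT K by exact: emeasurable_funD.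
have K0 x : (0 <= K x)%E by rewrite adde_ge0// lee_fin.
have bW : bounded_mfun (fun x => `|sM (sigma x) - sM x|).
  by apply/bmf_norm/bmfB => //; exact: bmf_comp.
have mW : measurable_fun setT (fun x => `|sM (sigma x) - sM x|%:E).
  by apply/measurable_EFinP; exact: bW.1.
have mKs : measurable_fun setT (fun x => K (sigma x)) by exact: measurableT_comp.
have intK : (\int[nu]_x K x <= (e / 5 + e / 5)%:E)%E.
  rewrite ge0_integralD// EFinD; exact: leeD.
apply: (@le_trans _ _ (\int[nu]_x
    (K (sigma x) + (K x + `|sM (sigma x) - sM x|%:E)))%E).
  apply: ge0_le_integral => //.
  - exact: measurableT_comp.
  - by apply: emeasurable_funD => //; exact: emeasurable_funD.
  move=> x _.
  have h1 := SM (N1 + N2)%N (sigma x); have h2 := SM (N1 + N2)%N x.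
  rewrite -/n -/s -/sM in h1 h2.
  apply: (@le_trans _ _ ((`|s (sigma x) - psi (sigma x)|%:E +
      `|s (sigma x) - sM (sigma x)|%:E) +
    ((`|s x - psi x|%:E + `|s x - sM x|%:E) + `|sM (sigma x) - sM x|%:E))%E).
    rewrite -!EFinD lee_fin.
    have -> : psi (sigma x) - psi x = - (s (sigma x) - psi (sigma x)) +
      (s (sigma x) - sM (sigma x)) + ((s x - psi x) - (s x - sM x)
      + (sM (sigma x) - sM x)) by ring.
    apply: (le_trans (ler_normD _ _)); apply: lerD.
      by apply: (le_trans (ler_normD _ _)); rewrite normrN.
    apply: (le_trans (ler_normD _ _)); rewrite lerD2r.
    exact: ler_normB.
  by rewrite /K; apply: leeD; [exact: leeD2l|apply: leeD => //; exact: leeD2l].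
rewrite ge0_integralD//; last 2 first.
- by move=> x _; rewrite adde_ge0// lee_fin.
- exact: emeasurable_funD.
rewrite [X in (_ + X)%E]ge0_integralD//.
rewrite (ge0_integral_preserving msig nusig mK K0).
rewrite -EFin_mean//.
apply: (@le_trans _ _ ((e / 5 + e / 5)%:E + ((e / 5 + e / 5)%:E + (e / 5)%:E))%E).
  apply: leeD => //; apply: leeD => //.
rewrite -!EFinD lee_fin.
suff -> : e / 5 + e / 5 + (e / 5 + e / 5 + e / 5) = e by [].
by field.
Qed.

End SphereAverages.

(** * Actions of the free group *)

Lemma ae_preserving (d : measure_display) (X : measurableType d) (R : realType)
    (nu : probability X R) (sigma : X -> X) (Q : X -> Prop) :
  measurable_fun setT sigma ->
  (forall B, measurable B -> nu (sigma @^-1` B) = nu B) ->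
  {ae nu, forall x, Q x} -> {ae nu, forall x, Q (sigma x)}.
Proof.
move=> msig nusig [B [mB B0 QB]]; exists (sigma @^-1` B); split.
- by rewrite -[X in measurable X]setTI; exact: msig.
- by rewrite nusig.
- by move=> x nQ; exact: QB.
Qed.

Section FreeGroupAction.
Context (R : realType) (m : nat) (d : measure_display) (X : measurableType d).
Context (nu : probability X R) (T : freegroup m -> X -> X).
Context (P : letter m -> letter m -> R) (p : letter m -> R).
Hypothesis actT : mp_action nu T.
Hypothesis stochP : is_stochastic P.
Hypothesis stat : is_unique_stationary P p.
Hypothesis p0 : forall i, 0 < p i.
Hypothesis genP : generates_free_group P.
Hypothesis p_opp : forall i, p i = p (letter_opp i).
Hypothesis revP : forall i j, P (letter_opp i) (letter_opp j) = p j * P j i / p i.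

(** The action of the inverse of j: the function T_j phi takes at x the value
    of phi at this point. *)
Definition letter_act (j : letter m) (x : X) : X := T (fg_gen (letter_opp j)) x.
(** The transition probabilities of the stationary chain run backwards: a
    weighted word is a trajectory of P read from its last letter to its first,
    while the iterates of the Markov operator read it from its first letter
    on. *)
Definition reversed_trans (j i : letter m) : R := p i * P i j / p j.

(** Without generators there is no distribution on the letters, and with a
    single one the chain never leaves its letter, so that any point mass is
    stationary. *)
Lemma rank_gt1 : (1 < m)%N.
Proof.
have [[[_ psum] _] uniq_p] := stat.
case: m P p stochP genP p0 psum uniq_p => [|[|//]] P' p' stP' gP' p'0 psum uniq_p.
  by move: psum; rewrite big1 => [/eqP|[_ []//]]; rewrite eq_sym oner_eq0.
have letter1 (i j : letter 1) : i != j -> j = letter_opp i.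
  case: i j => [b i] [b' j]; rewrite /letter_opp /= (ord1 i) (ord1 j).
  by case: b b' => -[].
have P_off (i j : letter 1) : i != j -> P' i j = 0.
  by move=> ij; apply/gP'; exact: letter1.
have P_diag (i : letter 1) : P' i i = 1.
  have [_] := stP' i; rewrite (bigD1 i)//= big1 ?addr0// => j ji.
  by apply: P_off; rewrite eq_sym.
pose i0 : letter 1 := (false, ord0).
have stq : is_stationary P' (fun i => (i == i0)%:R).
  split; first split.
  - by move=> i; rewrite ler0n.
  - by rewrite (bigD1 i0)//= ?eqxx big1 ?addr0// => i /negbTE ->.
  move=> j; rewrite (bigD1 i0)//= ?eqxx mul1r big1 ?addr0 => [|i /negbTE ->].
    have [->|ji] := eqVneq j i0; first exact: P_diag.
    by apply: P_off; rewrite eq_sym.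
  by rewrite mul0r.
have := uniq_p _ stq (true, ord0); have := p'0 (true, ord0).
by move=> /[swap] <-; rewrite ltxx.
Qed.

Lemma letter_act_inv (j : letter m) x : letter_act j x = T ((fg_gen j)^-1)%g x.
Proof. by rewrite /letter_act fg_gen_opp. Qed.

Lemma free_group_chain :
  reversible_chain nu (@letter_opp m) letter_act p reversed_trans.
Proof.
have p_neq0 i : p i != 0 by rewrite gt_eqF.
have P_ge0 i j : 0 <= P i j by case: (stochP i).
have [[[_ psum] statp] _] := stat.
split => //.
- exact: letter_oppK.
- by move=> j; exact: mp_action_measurable actT _.
- by move=> j B; exact: mp_action_measure actT _ _.
- move=> j x; rewrite /letter_act -(mp_actionM actT) fg_gen_opp mulVg.
  exact: mp_action1 actT x.
- by move=> j i; rewrite divr_ge0// ?mulr_ge0// ltW.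
- by move=> j; rewrite /reversed_trans -mulr_suml statp divff.
- move=> j i ij; rewrite divr_gt0// mulr_gt0// lt_neqAle P_ge0 andbT eq_sym.
  apply: contra ij => /eqP /genP ->; rewrite letter_oppK//.
- move=> j i; rewrite /reversed_trans revP -!p_opp.
  by field; rewrite !p_neq0.
- by rewrite card_prod card_bool card_ord; have := rank_gt1; lia.
Qed.

(** The (n+1)-st iterate at the letter j collects, up to the factor p j, the
    words of length n + 1 beginning with j: prepending a letter to a word is
    one more step of the reversed chain. *)
Lemma spherical_sum_sphere n (phi : X -> R) x :
  spherical_sum P p T n phi x =
  sphere letter_act p reversed_trans n phi x.
Proof.
pose F (w : seq (letter m)) (y : X) := word_weight P p w * fun_act T (fg_of_word w) phi y.
have headE n' j y : p j * iter n'.+1 (step letter_act reversed_trans) (fun _ => phi) j y =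
    \sum_(w : n'.-tuple (letter m)) F (j :: w) y.
  elim: n' j y => [|n' IHn] j y.
    rewrite /= /step -mulr_suml (rc_q_sum free_group_chain) mul1r.
    rewrite (big_pred1 [tuple]); last by move=> w; apply/esym/eqP/val_inj; case: w => -[].
    rewrite /F /word_weight /= mulr1 /fun_act /fg_of_word big_seq1 /=.
    by rewrite letter_act_inv.
  rewrite iterS /step mulr_sumr.
  transitivity (\sum_i \sum_(w : n'.-tuple (letter m)) P i j * F (i :: w) (letter_act j y)).
    apply: eq_bigr => i _; rewrite -mulr_sumr -IHn /reversed_trans.
    by field; rewrite gt_eqF.
  rewrite pair_big_dep /=.
  rewrite (reindex (fun iw : letter m * n'.-tuple (letter m) => [tuple of iw.1 :: iw.2])) /=.
    apply: eq_bigr => -[i w] _ /=; rewrite /F /word_weight /=.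
    have -> : fun_act T (fg_of_word [:: j, i & w]) phi y =
        fun_act T (fg_of_word (i :: w)) phi (letter_act j y).
      rewrite /fun_act /fg_of_word big_cons /= invgM (mp_actionM actT).
      by rewrite letter_act_inv.
    by ring.
  exists (fun w : n'.+1.-tuple (letter m) => (thead w, [tuple of behead w])).
    by move=> [i w] _ /=; congr (_, _); apply: val_inj.
  by move=> w _ /=; rewrite -tuple_eta.
case: n => [|n].
  rewrite /spherical_sum /sphere (big_pred1 [tuple]); last first.
    by move=> w; apply/esym/eqP/val_inj; case: w => -[].
  rewrite /= -mulr_suml (rc_p_sum free_group_chain) mul1r.
  by rewrite mul1r /fun_act /fg_of_word big_nil invg1 /= (mp_action1 actT).
rewrite /spherical_sum /sphere.
under [RHS]eq_bigr do rewrite headE.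
rewrite pair_big_dep /=.
rewrite (reindex (fun iw : letter m * n.-tuple (letter m) => [tuple of iw.1 :: iw.2])) //=.
exists (fun w : n.+1.-tuple (letter m) => (thead w, [tuple of behead w])).
  by move=> [i w] _ /=; congr (_, _); apply: val_inj.
by move=> w _ /=; rewrite -tuple_eta.
Qed.

Lemma fg_of_wordK (g : freegroup m) : fg_of_word g = g.
Proof.
apply: val_inj; case: g => w /=; rewrite /fg_of_word.
elim: w => [|i w IHw] rw; first by rewrite big_nil.
rewrite big_cons /= IHw; last exact: path_sorted rw.
by case: w rw {IHw} => //= j w /andP[/negbTE -> _].
Qed.

Lemma fun_act_word2 i j (w : seq (letter m)) (psi : X -> R) x :
  fun_act T (fg_of_word [:: i, j & w]) psi x =
  fun_act T (fg_of_word w) psi (letter_act j (letter_act i x)).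
Proof.
rewrite /fun_act /fg_of_word !big_cons /= !invgM !(mp_actionM actT).
by rewrite !letter_act_inv.
Qed.

(** An even word is read two letters at a time. *)
Lemma even_invariant (psi : X -> R) :
  (forall a b, {ae nu, forall x, psi (letter_act b (letter_act a x)) = psi x}) ->
  forall g, fg_even g -> {ae nu, forall x, fun_act T g psi x = psi x}.
Proof.
move=> inv2 g; rewrite /fg_even => even_g; rewrite -(fg_of_wordK g).
move: (fgword g) even_g => {g} w; have [n] := ubnP (size w); elim: n w => // n IHn.
case=> [_ _|i [//|j w]] /=.
  apply: aeW => x; rewrite /fun_act /fg_of_word big_nil invg1 /=.
  by rewrite (mp_action1 actT).
rewrite !negbK => sz ev.
have {}IHn := IHn w (leq_trans (leqnSn _) sz) ev.
have := ae_preserving (mp_action_measurable actT _) (mp_action_measure actT _) IHn.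
move=> /(_ (fg_gen (letter_opp j))).
move/(ae_preserving (mp_action_measurable actT (fg_gen (letter_opp i)))
  (mp_action_measure actT _)).
apply: filterS2 (inv2 i j) => x psix; rewrite fun_act_word2 => ->.
exact: psix.
Qed.

End FreeGroupAction.

Theorem theorem1 (R : realType) (m : nat)
    (d : measure_display) (X : measurableType d) (nu : probability X R)
    (T : freegroup m -> X -> X)
    (P : letter m -> letter m -> R) (p : letter m -> R) :
  is_lebesgue_space nu ->
  mp_action nu T ->
  is_stochastic P ->
  is_unique_stationary P p ->
  (forall i, 0 < p i) ->
  generates_free_group P ->
  (forall i, p i = p (letter_opp i)) ->
  (forall i j, P (letter_opp i) (letter_opp j) = p j * P j i / p i) ->
  forall phi : X -> R, LlogL nu phi ->
  exists psi : X -> R,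
    [/\ nu.-integrable setT (EFin \o psi),
        (forall g, fg_even g -> {ae nu, forall x, fun_act T g psi x = psi x}),
        {ae nu, forall x,
           (fun n => spherical_sum P p T (2 * n) phi x) @ \oo --> psi x} &
        (fun n => \int[nu]_x
           `|spherical_sum P p T (2 * n) phi x - psi x|%:E)%E @ \oo --> 0%E].
Proof.
move=> _ actT stochP stat p0 genP p_opp revP phi Lphi.
have C := free_group_chain actT stochP stat p0 genP p_opp revP.
have sE n x : spherical_sum P p T (2 * n) phi x =
    sphere (letter_act T) p (reversed_trans P p) n.*2 phi x.
  by rewrite mul2n (spherical_sum_sphere actT stochP stat p0 genP p_opp revP).
have [psi [ipsi inv2 aecv L1]] := sphere_limit C Lphi.
exists psi; split => //.
- exact: even_invariant inv2.
- by apply: filterS aecv => x; under [in X in _ -> X]eq_fun do rewrite sE.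
- rewrite (_ : (fun n => _) = fun n => (\int[nu]_x
    `|sphere (letter_act T) p (reversed_trans P p) n.*2 phi x - psi x|%:E)%E) //.
  by apply/funext => n; apply: eq_integral => x _; rewrite sE.
Qed.
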